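(* Let $c:[0,L]\to\mathbb{R}^3$ be a rectifiable curve of class $C^3$ parameterized by arc-length, so that $L=\mathcal{L}(c)$. Assume that $\ddot c(s)\neq0$ for each $s\in[0,L]$, so that the Frenet frame $(\mathfrak{t},\mathfrak{n},\mathfrak{b})$ of $c$ is well-defined, and that $T:=\mathrm{TAT}(c)\ne0$. Let $\mathfrak{b}_c:[0,T]\to\mathbb{RP}^2$ be the weak binormal of $c$. Then there is a unique continuous lifting $\widetilde{\mathfrak{b}}_c:[0,T]\to\mathbb{S}^2$ of $\mathfrak{b}_c$ such that for each $s\in\,]0,L[$ one has $$\mathfrak{b}(s)=\widetilde{\mathfrak{b}}_c(t(s)),$$ where $t(s)\in[0,T]$ is equal to the total absolute torsion $\mathrm{TAT}(c_{|[0,s]})$ of the curve $c_{|[0,s]}:[0,s]\to\mathbb{R}^3$. In particular, $$t(s)=\int_0^s|\boldsymbol{\tau}(\lambda)|\,d\lambda\qquad\forall\,s\in[0,L],$$ where $\boldsymbol{\tau}(\lambda)$ is the torsion of $c$ at the point $c(\lambda)$.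
   Context: Frenet frame: $\mathfrak{t}=\dot c$, $\mathfrak{n}=\ddot c/\|\ddot c\|$, $\mathfrak{b}=\mathfrak{t}\times\mathfrak{n}$; the torsion $\boldsymbol{\tau}$ is defined by $\dot{\mathfrak{b}}=-\boldsymbol{\tau}\,\mathfrak{n}$. $\mathbb{S}^2\subset\mathbb{R}^3$ is the unit sphere with geodesic distance $d_{\mathbb{S}^2}$; $\mathbb{RP}^2=\mathbb{S}^2/\{\pm1\}$ has elements $[y]$ and metric $d_{\mathbb{RP}^2}([y],[z])=\min\{d_{\mathbb{S}^2}(y,z),d_{\mathbb{S}^2}(y,-z)\}$. A lifting of a continuous $u:[0,T]\to\mathbb{RP}^2$ is a continuous $v:[0,T]\to\mathbb{S}^2$ with $[v]=u$. Polygonals. A polygonal $P$ in $\mathbb{R}^3$ has consecutive vertices $v_0,\dots,v_n$ and oriented segments $\sigma_i=[v_{i-1},v_i]$, identified with the vectors $v_i-v_{i-1}$, all of positive length (repeated consecutive vertices are discarded). The discrete binormals are $b_i:=\frac{\sigma_i\times\sigma_{i+1}}{\|\sigma_i\times\sigma_{i+1}\|}\in\mathbb{S}^2$, $i=1,\dots,n-1$. If $\sigma_i\times\sigma_{i+1}=0$, then in this formula $\sigma_{i+1}$ is replaced by $[v_i,v_{j+1}]$, where $j$ is the first index greater than $i$ with $\sigma_j\times\sigma_{j+1}\ne0$; if no such $j$ exists, $b_i:=b_{i-1}$. The total absolute torsion is $\mathrm{TAT}(P):=\sum_{i=2}^{n-1}d_{\mathbb{RP}^2}([b_{i-1}],[b_i])$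 (it is $0$ if $P$ is planar). If $P$ is closed ($v_0=v_n$), indices are taken cyclically and the sum runs over all $n$ segments. Let $\Gamma_i$ be the minimal geodesic arc in $\mathbb{RP}^2$ from $[b_{i-1}]$ to $[b_i]$. The binormal indicatrix $\mathfrak{b}_P:[0,\mathrm{TAT}(P)]\to\mathbb{RP}^2$ is the arc-length parameterization of the curve obtained by connecting the consecutive arcs $\Gamma_2,\dots,\Gamma_{n-1}$. Its constant-velocity parameterization on $[0,T]$ is $s\mapsto\mathfrak{b}_P(\mathrm{TAT}(P)s/T)$. For a curve $c:[a,b]\to\mathbb{R}^3$, $P\ll c$ ($P$ inscribed in $c$) means that there is a partition $a=\lambda_0<\dots<\lambda_n=b$ such that $P$ has vertices $v_i=c(\lambda_i)$. The modulus $\mu_c(P)$ is the maximum of the diameters of the arcs $c([\lambda_{i-1},\lambda_i])$. Define $\mathrm{TAT}(c):=\lim_{\varepsilon\to0^+}\sup\{\mathrm{TAT}(P):P\ll c,\ \mu_c(P)<\varepsilon\}$ (and $\mathrm{TAT}(c_{|[0,0]}):=0$). Weak binormal. For a curve $c$ with finite total curvature (supremum over inscribed polygonals of the sum of turning angles) and finite non-zero $T=\mathrm{TAT}(c)$, there is a unique curve $\mathfrak{b}_c:[0,T]\to\mathbb{RP}^2$, parameterized by arc-length, such that for every sequence $\{P_h\}$ of polygonals inscribed in $c$ with $\mu_c(P_h)\to0$, the constant-velocity parameterizations on $[0,T]$ of $\mathfrak{b}_{P_h}$ converge to $\mathfrak{b}_c$ uniformly; $\mathfrak{b}_c$ is called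 the weak binormal of $c$.
   Formalization: Closedness is a property of the curve, not the mere coincidence v_0=v_n: cyclic indices are used only for a curve taken as closed, which must close up with its first three derivatives; any other curve, and c restricted to [0,s] with s<L, gets the non-cyclic TAT even if c(s)=c(0). *)

(* Defs.v *)
From Stdlib Require Import Reals Lra Lia List.
From Stdlib Require Import FunctionalExtensionality PropExtensionality.
From Stdlib Require Import ProofIrrelevance ClassicalEpsilon.
From Coquelicot Require Import Coquelicot.
Import ListNotations.
Open Scope R_scope.

Definition R3 : Type := (R * R * R)%type.

Definition dot (x y : R3) : R :=
  let '(x1, x2, x3) := x in
  let '(y1, y2, y3) := y in
  x1 * y1 + x2 * y2 + x3 * y3.

Definition cross (x y : R3) : R3 :=
  let '(x1, x2, x3) := x in
  let '(y1, y2, y3) := y in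
  (x2 * y3 - x3 * y2, x3 * y1 - x1 * y3, x1 * y2 - x2 * y1).

(** Coquelicot's [norm] on a product is the l2-combination of the norms of the
    factors, so on [R3] it is the Euclidean norm. *)
Lemma norm_R3 (x : R3) : norm x = sqrt (dot x x).
Proof.
  destruct x as [[x1 x2] x3].
  change (norm ((x1, x2, x3) : R3))
    with (sqrt (sqrt (Rabs x1 ^ 2 + Rabs x2 ^ 2) ^ 2 + Rabs x3 ^ 2)).
  rewrite pow2_sqrt; [| apply Rplus_le_le_0_compat; apply pow2_ge_0].
  rewrite !pow2_abs; simpl dot; f_equal; ring.
Qed.

Definition dist3 (x y : R3) : R := norm (minus x y).

Lemma R3_eq_dec (x y : R3) : {x = y} + {x <> y}.
Proof. repeat decide equality; apply Req_EM_T. Defined.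

Definition S2 : Type := {x : R3 | norm x = 1}.

Definition S2val (y : S2) : R3 := proj1_sig y.

Lemma antipode_proof (y : S2) : norm (opp (S2val y)) = 1.
Proof.
  rewrite <- (proj2_sig y), !norm_R3; unfold S2val.
  destruct (proj1_sig y) as [[y1 y2] y3]; f_equal.
  unfold opp; simpl; unfold opp; simpl; ring.
Qed.

Definition antipode (y : S2) : S2 :=
  exist _ (opp (S2val y)) (antipode_proof y).

Lemma pole_proof : norm (((0, 0), 1) : R3) = 1.
Proof.
  rewrite norm_R3; transitivity (sqrt 1); [f_equal; simpl; ring | exact sqrt_1].
Qed.

Definition pole : S2 := exist _ _ pole_proof.

Lemma normalize_proof (x : R3) : x <> zero -> norm (scal (/ norm x) x) = 1.
Proof.
  intros hx.
  assert (h : 0 < norm x) by now apply norm_gt_0.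
  rewrite !norm_R3 in *.
  replace (dot (scal (/ sqrt (dot x x)) x) (scal (/ sqrt (dot x x)) x)) with 1.
  - apply sqrt_1.
  - assert (h2 : sqrt (dot x x) * sqrt (dot x x) = dot x x).
    { apply sqrt_sqrt.
      destruct x as [[x1 x2] x3]; simpl.
      nra. }
    set (r := sqrt (dot x x)) in *.
    replace (dot (scal (/ r) x) (scal (/ r) x)) with (/ r * / r * dot x x).
    + rewrite <- h2; field; lra.
    + destruct x as [[x1 x2] x3].
      cbv [scal]; simpl; cbv [scal]; simpl; cbv [mult]; simpl; ring.
Qed.

(** [x / |x|]; the value at [x = 0] is a dummy. *)
Definition normalize (x : R3) : S2 :=
  match R3_eq_dec x zero with
  | left _ => pole
  | right hx => exist _ (scal (/ norm x) x) (normalize_proof x hx)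
  end.

Definition dS2 (y z : S2) : R := acos (dot (S2val y) (S2val z)).

(** [RP2] is the quotient of [S2] by the antipodal relation: its elements are
    the equivalence classes, as subsets of [S2]. *)
Definition antipodal_pair (y : S2) : S2 -> Prop :=
  fun z => z = y \/ z = antipode y.

Definition RP2 : Type := {A : S2 -> Prop | exists y, A = antipodal_pair y}.

Definition cls (y : S2) : RP2 :=
  exist _ (antipodal_pair y) (ex_intro _ y eq_refl).

Definition repr (p : RP2) : S2 :=
  proj1_sig (constructive_indefinite_description _ (proj2_sig p)).

(** The choice of representatives is immaterial: see [dRP2_cls]. *)
Definition dRP2 (p q : RP2) : R :=
  Rmin (dS2 (repr p) (repr q)) (dS2 (repr p) (antipode (repr q))).

Lemma S2_eq (y z : S2) : S2val y = S2val z -> y = z.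
Proof.
  destruct y as [y hy], z as [z hz]; simpl; intros <-.
  f_equal; apply proof_irrelevance.
Qed.

Lemma antipodeK (y : S2) : antipode (antipode y) = y.
Proof. apply S2_eq; simpl; apply opp_opp. Qed.

Lemma cls_eq (y z : S2) : cls y = cls z <-> y = z \/ y = antipode z.
Proof.
  split.
  - intros h; apply (f_equal (@proj1_sig _ _)) in h; simpl in h.
    change (antipodal_pair z y); rewrite <- h; now left.
  - intros h; unfold cls.
    assert (e : antipodal_pair y = antipodal_pair z).
    { apply functional_extensionality; intros w.
      apply propositional_extensionality; unfold antipodal_pair.
      destruct h as [-> | ->]; rewrite ?antipodeK; tauto. }
    generalize (ex_intro (fun y0 => antipodal_pair y = antipodal_pair y0)
                  y eq_refl).
    rewrite e; intros h'; f_equal; apply proof_irrelevance.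
Qed.

Lemma cls_repr (p : RP2) : cls (repr p) = p.
Proof.
  unfold repr.
  destruct (constructive_indefinite_description _ _) as [y hy]; simpl.
  destruct p as [A hA]; simpl in hy; subst A.
  unfold cls; f_equal; apply proof_irrelevance.
Qed.

Lemma dot_opp_l (x y : R3) : dot (opp x) y = - dot x y.
Proof.
  destruct x as [[x1 x2] x3], y as [[y1 y2] y3].
  unfold opp; simpl; unfold opp; simpl; ring.
Qed.

Lemma dot_opp_r (x y : R3) : dot x (opp y) = - dot x y.
Proof.
  destruct x as [[x1 x2] x3], y as [[y1 y2] y3].
  unfold opp; simpl; unfold opp; simpl; ring.
Qed.

Lemma dRP2_cls (y z : S2) :
  dRP2 (cls y) (cls z) = Rmin (dS2 y z) (dS2 y (antipode z)).
Proof.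
  assert (hy := proj1 (cls_eq _ _) (cls_repr (cls y))).
  assert (hz := proj1 (cls_eq _ _) (cls_repr (cls z))).
  unfold dRP2, dS2.
  assert (ho : forall w, S2val (antipode w) = opp (S2val w)) by reflexivity.
  destruct hy as [-> | ->], hz as [-> | ->]; rewrite ?ho, ?opp_opp,
    ?dot_opp_l, ?dot_opp_r, ?Ropp_involutive; trivial; apply Rmin_comm.
Qed.

Record partition (a b : R) : Type := Partition {
  psize : nat;
  node : nat -> R;
  node_first : node 0%nat = a;
  node_last : node psize = b;
  node_incr : forall i, (i < psize)%nat -> node i < node (S i) }.
Arguments psize {a b} _.
Arguments node {a b} _ _.

Definition sum_over (l : list nat) (f : nat -> R) : R :=
  fold_right Rplus 0 (map f l).

Definition is_length {X : Type} (d : X -> X -> R) (u : R -> X)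
    (a b l : R) : Prop :=
  is_lub (fun r => exists p : partition a b,
            r = sum_over (seq 0 (psize p))
                  (fun i => d (u (node p i)) (u (node p (S i))))) l.

Definition arc_length_param {X : Type} (d : X -> X -> R) (u : R -> X)
    (a b : R) : Prop :=
  forall x y, a <= x -> x <= y -> y <= b -> is_length d u x y (y - x).

(** Whether a curve, and then every polygonal inscribed in it, is regarded as
    an arc or as a closed curve, with cyclic indices. This is a datum of the
    curve and not the mere coincidence of the end points: an arc may pass
    again through its initial point, with a different direction. *)
Inductive kind : Type := Arc | Closed.

(** A polygonal is the list [v_0, ..., v_n] of its vertices. *)
Definition nsegs (P : list R3) : nat := (length P - 1)%nat.

Definition vertex (k : kind) (P : list R3) (i : nat) : R3 :=
  match k with
  | Arc => nth i P zero
  | Closed => nth (i mod nsegs P)%nat P zero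
  end.

Definition segment (k : kind) (P : list R3) (i : nat) : R3 :=
  minus (vertex k P i) (vertex k P (i - 1)).

Definition seg_cross (k : kind) (P : list R3) (i : nat) : R3 :=
  cross (segment k P i) (segment k P (S i)).

Fixpoint first_turn (k : kind) (P : list R3) (j fuel : nat) : option nat :=
  match fuel with
  | O => None
  | S f => if R3_eq_dec (seg_cross k P j) zero
           then first_turn k P (S j) f else Some j
  end.

(** The number of indices following [i] at which there is a turn to look for:
    [i + 1, ..., n - 1] on an arc, a whole period on a closed polygonal. *)
Definition turns_after (k : kind) (P : list R3) (i : nat) : nat :=
  match k with
  | Arc => nsegs P - 1 - i
  | Closed => nsegs P - 1
  end.

(** [b_i]; when all the segments are parallel every [b_i] is the dummy
    [pole]. *)
Fixpoint binormal (k : kind) (P : list R3) (i : nat) : S2 :=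
  if R3_eq_dec (seg_cross k P i) zero then
    match first_turn k P (S i) (turns_after k P i) with
    | Some j =>
        normalize (cross (segment k P i)
                         (minus (vertex k P (S j)) (vertex k P i)))
    | None => match i with O => pole | S i' => binormal k P i' end
    end
  else normalize (seg_cross k P i).

(** The arcs of the indicatrix are [Gamma_i] with [2 <= i <= n - 1] for an arc,
    and [2 <= i <= n + 1], with [Gamma_(n+1) = Gamma_1], for a closed
    polygonal. *)
Definition narcs (k : kind) (P : list R3) : nat :=
  match k with
  | Arc => nsegs P - 2
  | Closed => nsegs P
  end.

Definition arcs_length (k : kind) (P : list R3) (m : nat) : R :=
  sum_over (seq 2 m)
    (fun i => dRP2 (cls (binormal k P (i - 1))) (cls (binormal k P i))).

Definition polyTAT (k : kind) (P : list R3) : R :=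
  arcs_length k P (narcs k P).

(** The minimal geodesic arcs, parameterized by arc-length, are the isometric
    images of intervals. When the distance of the end points is [PI / 2] the
    minimal arc is not unique, and any of them is allowed. *)
Definition is_binormal_indicatrix (k : kind) (P : list R3)
    (u : R -> RP2) : Prop :=
  (forall m, (m <= narcs k P)%nat ->
     u (arcs_length k P m) = cls (binormal k P (S m))) /\
  (forall m, (m < narcs k P)%nat ->
     forall x y,
       arcs_length k P m <= x <= arcs_length k P (S m) ->
       arcs_length k P m <= y <= arcs_length k P (S m) ->
       dRP2 (u x) (u y) = Rabs (x - y)).

Fixpoint discard_repeated (l : list R3) : list R3 :=
  match l with
  | [] => []
  | x :: l' =>
      match l' with
      | [] => [x]
      | y :: _ => if R3_eq_dec x y then discard_repeated l'
                  else x :: discard_repeated l'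
      end
  end.

Definition inscribed {a b : R} (c : R -> R3) (p : partition a b) : list R3 :=
  discard_repeated (map (fun i => c (node p i)) (seq 0 (S (psize p)))).

Definition diam (c : R -> R3) (x y : R) : R :=
  real (Lub_Rbar (fun r => exists s s', x <= s <= y /\ x <= s' <= y /\
                                        r = dist3 (c s) (c s'))).

Definition modulus {a b : R} (c : R -> R3) (p : partition a b) : R :=
  fold_right Rmax 0
    (map (fun i => diam c (node p i) (node p (S i))) (seq 0 (psize p))).

Definition TAT_sup (k : kind) (c : R -> R3) (a b eps : R) : Rbar :=
  Lub_Rbar (fun r => exists p : partition a b,
              modulus c p < eps /\ r = polyTAT k (inscribed c p)).

(** Limit as the argument tends to [0+], in the order topology of [Rbar]. *)
Definition is_Rbar_lim_right0 (f : R -> Rbar) (l : Rbar) : Prop :=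
  (forall x, Rbar_lt x l -> at_right 0 (fun e => Rbar_lt x (f e))) /\
  (forall y, Rbar_lt l y -> at_right 0 (fun e => Rbar_lt (f e) y)).

(** The limit always exists: see [TAT_correct]. *)
Definition TAT (k : kind) (c : R -> R3) (a b : R) : Rbar :=
  epsilon (inhabits (Finite 0)) (is_Rbar_lim_right0 (TAT_sup k c a b)).

Lemma TAT_correct (k : kind) (c : R -> R3) (a b : R) :
  is_Rbar_lim_right0 (TAT_sup k c a b) (TAT k c a b).
Proof.
  unfold TAT; apply epsilon_spec.
  set (f := TAT_sup k c a b).
  assert (hf : forall e e', e <= e' -> Rbar_le (f e) (f e')).
  { intros e e' h; unfold f, TAT_sup, Lub_Rbar.
    destruct (ex_lub_Rbar _) as [l1 [hl1 hl1']]; simpl.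
    destruct (ex_lub_Rbar _) as [l2 [hl2 hl2']]; simpl.
    apply hl1'; intros r [p [hp hr]]; apply hl2; exists p; split; trivial.
    lra. }
  destruct (Rbar_ex_glb (fun v => exists e, 0 < e /\ v = f e)) as [l [hl hl']].
  exists l; split.
  - intros x hx; exists (mkposreal 1 Rlt_0_1); intros e _ he.
    apply Rbar_lt_le_trans with l; trivial; apply hl; now exists e.
  - intros y hy.
    destruct (excluded_middle_informative
                (exists e, 0 < e /\ Rbar_lt (f e) y)) as [[e [he hy']] | hn].
    + exists (mkposreal e he); intros e' he' he0.
      apply Rbar_le_lt_trans with (f e); trivial; apply hf.
      revert he'; unfold ball; simpl; unfold AbsRing_ball, minus, plus, opp, abs;
        simpl.
      rewrite Rabs_pos_eq; lra.
    + exfalso; apply (Rbar_lt_not_le _ _ hy); apply hl'.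
      intros v [e [he ->]]; apply Rbar_not_lt_le; intros h; apply hn.
      now exists e.
Qed.

Lemma is_Rbar_lim_right0_unique (f : R -> Rbar) (l l' : Rbar) :
  is_Rbar_lim_right0 f l -> is_Rbar_lim_right0 f l' -> l = l'.
Proof.
  assert (H : forall l l', is_Rbar_lim_right0 f l ->
                is_Rbar_lim_right0 f l' -> ~ Rbar_lt l l').
  { intros a b [_ ha] [hb _] hab.
    assert (hm : exists m, Rbar_lt a m /\ Rbar_lt m b).
    { destruct a as [a | |], b as [b | |]; simpl in hab; try contradiction.
      - exists (Finite ((a + b) / 2)); simpl; lra.
      - exists (Finite (a + 1)); simpl; split; trivial; lra.
      - exists (Finite (b - 1)); simpl; split; trivial; lra.
      - exists (Finite 0); simpl; tauto. }
    destruct hm as [m [h1 h2]].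
    destruct (filter_ex (F := at_right 0) _ (filter_and _ _ (ha m h1) (hb m h2)))
      as [e [he1 he2]].
    apply (Rbar_lt_not_le _ _ he1); now apply Rbar_lt_le. }
  intros h h'; apply Rbar_le_antisym; apply Rbar_not_lt_le; now apply H.
Qed.

Lemma TAT_point (k : kind) (c : R -> R3) (a : R) : TAT k c a a = Finite 0.
Proof.
  apply (is_Rbar_lim_right0_unique (TAT_sup k c a a)); [apply TAT_correct |].
  assert (hp : forall p : partition a a, psize p = 0%nat).
  { intros p; destruct (psize p) as [| n] eqn:hn; trivial; exfalso.
    assert (h : forall i, (i <= n)%nat -> a < node p (S i)).
    { induction i as [| i IH]; intros hi.
      - rewrite <- (node_first _ _ p) at 1; apply node_incr; lia.
      - apply Rlt_trans with (node p (S i)); [apply IH; lia |].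
        apply node_incr; lia. }
    specialize (h n (Nat.le_refl n)).
    assert (e := node_last _ _ p); rewrite hn in e; lra. }
  assert (h0 : forall p : partition a a, polyTAT k (inscribed c p) = 0).
  { intros p; unfold inscribed; rewrite (hp p); simpl.
    now destruct k. }
  assert (hs : forall e, 0 < e -> TAT_sup k c a a e = Finite 0).
  { intros e he; apply is_lub_Rbar_unique; split.
    - intros r [p [_ ->]]; rewrite h0; apply Rle_refl.
    - intros b hb; apply hb.
      exists (Partition a a 0 (fun _ => a) eq_refl eq_refl
                (fun i hi => False_ind _ (Nat.nlt_0_r i hi))).
      split; [exact he | now rewrite h0]. }
  split; intros x hx; exists (mkposreal 1 Rlt_0_1); intros e _ he;
    now rewrite hs.
Qed.

(** The kind of the restriction to [[0, s]] of a curve of kind [k] on [[0, L]]: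
    a proper sub-arc of a closed curve is an arc. *)
Definition sub_kind (k : kind) (L s : R) : kind :=
  if Req_EM_T s L then k else Arc.

Definition is_weak_binormal (k : kind) (c : R -> R3) (a b T : R)
    (bc : R -> RP2) : Prop :=
  arc_length_param dRP2 bc 0 T /\
  forall (P : nat -> partition a b) (u : nat -> R -> RP2),
    is_lim_seq (fun h => modulus c (P h)) 0 ->
    (forall h, is_binormal_indicatrix k (inscribed c (P h)) (u h)) ->
    forall eps, 0 < eps ->
      exists N, forall h, (N <= h)%nat -> forall s, 0 <= s <= T ->
        dRP2 (u h (polyTAT k (inscribed c (P h)) * s / T)) (bc s) < eps.

Definition is_lifting (T : R) (u : R -> RP2) (v : R -> S2) : Prop :=
  continuous_on (fun x => 0 <= x <= T) (fun x => S2val (v x)) /\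
  forall x, 0 <= x <= T -> cls (v x) = u x.

(** Derivative relative to [[a, b]], hence one-sided at the end points. *)
Definition is_derive_in (a b : R) (f : R -> R3) (s : R) (l : R3) : Prop :=
  filterdiff f (within (fun x => a <= x <= b) (locally s)) (fun h => scal h l).

Definition class_C3 (a b : R) (c c1 c2 c3 : R -> R3) : Prop :=
  (forall s, a <= s <= b ->
     is_derive_in a b c s (c1 s) /\
     is_derive_in a b c1 s (c2 s) /\
     is_derive_in a b c2 s (c3 s)) /\
  continuous_on (fun x => a <= x <= b) c3.

(** The periodic extension of [c] is again of class [C^3]. *)
Definition closes_C3 (a b : R) (c c1 c2 c3 : R -> R3) : Prop :=
  c a = c b /\ c1 a = c1 b /\ c2 a = c2 b /\ c3 a = c3 b.

Definition frenet_t (c1 : R -> R3) (s : R) : R3 := c1 s.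

Definition frenet_n (c2 : R -> R3) (s : R) : R3 := scal (/ norm (c2 s)) (c2 s).

Definition frenet_b (c1 c2 : R -> R3) (s : R) : R3 :=
  cross (frenet_t c1 s) (frenet_n c2 s).

Definition is_torsion (a b : R) (c1 c2 : R -> R3) (tau : R -> R) : Prop :=
  forall s, a <= s <= b ->
    is_derive_in a b (frenet_b c1 c2) s (scal (- tau s) (frenet_n c2 s)).

(* Main.v *)
From Stdlib Require Import Arith Reals Lra Lia List.
From Stdlib Require Import ClassicalEpsilon.
From Coquelicot Require Import Coquelicot.
Require Import Defs.
Open Scope R_scope.

(** For three nodes [x < y < z] the normal of the plane through the points
    [C x], [C y], [C z] is a positive multiple of [C[y,z] × C[x,y,z]], where the
    brackets are divided differences, and tends to the direction of
    [C' × C''], that is to the binormal, when the nodes shrink to one point.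
    The planes of four consecutive nodes [x < y < z < w] share the chord from
    [C y] to [C z], so that the cross product of their normals is a multiple of
    [C[y,z]] by [(w - x) det (C[y,z], C[x,y,z], C[x,y,z,w])]. Since the distance
    in the projective plane is the arc sine of the norm of the cross product of
    unit vectors, the distance of the two discrete binormals is
    [asin ((w - x) Q)], where [Q] is an explicit quotient of divided
    differences ([dRP2_binormals]). By the mean value property of divided
    differences, [Q] tends to one third of the absolute torsion, whatever the
    ratios of the gaps between the nodes ([near4_torsion_quotient]).

    Let [F] be the primitive of the absolute torsion. By compactness of the
    interval, each distance differs from [(F w - F x) / 3] by at most
    [eps (w - x)], uniformly in the nodes. The sum telescopes: it counts every
    interval three times, except near the ends, so that all partial sums for a
    fine polygonal are close to the values of [F] at the nodes
    ([node_estimate]). A closed polygonal is unrolled along the periodic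
    extension of the curve, so that the cyclic case is covered as well
    ([polygonal_estimate]). Therefore the total absolute torsion of every
    restriction to [[0, s]] is [F s] ([TAT_eq]).

    The binormal indicatrix of a fine polygonal takes, at a parameter close to
    [F s], a value close to the class of the binormal at [s]. In the limit the
    weak binormal at [F s] is the class of the binormal at [s]
    ([weak_binormal_value]). As the binormal moves with speed equal to the
    absolute torsion, its variation is bounded by that of [F]
    ([frenet_b_lipschitz]): it is a 1-Lipschitz function of [F s], and that
    function is the lifting. It is unique because [F] maps the open interval
    onto a set containing all interior parameters. *)


(** * Vectors of the Euclidean space *)

Definition coord (j : nat) (v : R3) : R :=
  let '(x, y, z) := v in match j with 0%nat => x | 1%nat => y | _ => z end.

(** Reduces the operations of the vector space to the coordinates. *)
Ltac vec :=
  repeat match goal with v : R3 |- _ => destruct v as [[? ?] ?] end;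
  cbv [coord dot cross minus plus opp scal zero]; simpl;
  cbv [prod_plus prod_opp prod_scal prod_zero plus opp scal zero mult]; simpl;
  cbv [prod_plus prod_opp prod_scal prod_zero plus opp scal zero mult]; simpl.

Lemma R3_ext (u v : R3) : (forall j, coord j u = coord j v) -> u = v.
Proof.
  intros h; assert (h0 := h 0%nat); assert (h1 := h 1%nat).
  assert (h2 := h 2%nat); destruct u as [[u1 u2] u3], v as [[v1 v2] v3].
  simpl in *; congruence.
Qed.

Lemma coord_le_norm (j : nat) (v : R3) : Rabs (coord j v) <= norm v.
Proof.
  rewrite norm_R3, <- sqrt_Rsqr_abs; apply sqrt_le_1_alt.
  destruct v as [[x y] z]; unfold Rsqr, coord, dot.
  destruct j as [| [| j]]; nra.
Qed.

Lemma norm_sqr (v : R3) : norm v * norm v = dot v v.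
Proof. rewrite norm_R3; apply sqrt_sqrt; vec; nra. Qed.

Lemma norm_eq (v : R3) (r : R) : 0 <= r -> dot v v = r * r -> norm v = r.
Proof. intros hr e; rewrite norm_R3, e; now apply sqrt_square. Qed.

Lemma norm_scal_abs (r : R) (v : R3) : norm (scal r v) = Rabs r * norm v.
Proof.
  apply norm_eq.
  - apply Rmult_le_pos; [apply Rabs_pos | apply norm_ge_0].
  - replace (Rabs r * norm v * (Rabs r * norm v))
      with (Rsqr (Rabs r) * (norm v * norm v)) by (unfold Rsqr; ring).
    rewrite <- Rsqr_abs, norm_sqr; unfold Rsqr; vec; ring.
Qed.

Lemma norm_scal_pos (r : R) (v : R3) : 0 <= r -> norm (scal r v) = r * norm v.
Proof. intros hr; now rewrite norm_scal_abs, Rabs_pos_eq. Qed.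

Lemma norm_le_dot (v : R3) (r : R) :
  0 <= r -> dot v v <= r * r -> norm v <= r.
Proof.
  intros hr h; rewrite norm_R3, <- (sqrt_square r hr); now apply sqrt_le_1_alt.
Qed.

Lemma dot_le_norm (u v : R3) : dot u v <= norm u * norm v.
Proof.
  apply Rsqr_incr_0_var; unfold Rsqr.
  - replace (norm u * norm v * (norm u * norm v))
      with (norm u * norm u * (norm v * norm v)) by ring.
    rewrite !norm_sqr.
    assert (e : dot u u * dot v v - dot u v * dot u v
                = dot (cross u v) (cross u v)) by (vec; ring).
    assert (0 <= dot (cross u v) (cross u v)).
    { rewrite <- norm_sqr; apply Rle_0_sqr. }
    lra.
  - apply Rmult_le_pos; apply norm_ge_0.
Qed.

Lemma norm_pos (v : R3) : v <> zero -> 0 < norm v.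
Proof. intros h; now apply norm_gt_0. Qed.

Lemma norm_0 : norm (zero : R3) = 0.
Proof. apply norm_eq; [lra | vec; ring]. Qed.

Lemma norm_neq0 (v : R3) : 0 < norm v -> v <> zero.
Proof. intros h ->; rewrite norm_0 in h; lra. Qed.

Lemma dist3_sym (u v : R3) : dist3 u v = dist3 v u.
Proof. unfold dist3; rewrite !norm_R3; f_equal; vec; ring. Qed.

Lemma dist3_triangle (u v w : R3) : dist3 u w <= dist3 u v + dist3 v w.
Proof.
  unfold dist3; assert (h := dot_le_norm (minus u v) (minus v w)).
  assert (h1 := norm_sqr (minus u v)); assert (h2 := norm_sqr (minus v w)).
  assert (p1 := norm_ge_0 (minus u v)); assert (p2 := norm_ge_0 (minus v w)).
  apply norm_le_dot; [now apply Rplus_le_le_0_compat |].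
  replace (dot (minus u w) (minus u w))
    with (dot (minus u v) (minus u v) + dot (minus v w) (minus v w)
          + 2 * dot (minus u v) (minus v w)) by (vec; ring).
  rewrite <- h1, <- h2; clear h1 h2.
  eapply Rle_trans; [apply Rplus_le_compat_l, Rmult_le_compat_l, h; lra |].
  apply Req_le; ring.
Qed.

Lemma dist3_ge0 (u v : R3) : 0 <= dist3 u v.
Proof. apply norm_ge_0. Qed.

Lemma dist3_refl (u : R3) : dist3 u u = 0.
Proof. unfold dist3; apply norm_eq; [lra | vec; ring]. Qed.

Lemma dist3_eq0 (u v : R3) : dist3 u v = 0 -> u = v.
Proof.
  intros h; apply R3_ext; intros j.
  assert (hj := coord_le_norm j (minus u v)).
  unfold dist3 in h; rewrite h in hj.
  assert (e : coord j (minus u v) = coord j u - coord j v)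
    by (destruct j as [| [| j]]; vec; ring).
  rewrite e in hj; revert hj; unfold Rabs; destruct (Rcase_abs _); lra.
Qed.

Lemma dist3_coords (u v : R3) (r : R) :
  (forall j, Rabs (coord j u - coord j v) <= r) -> dist3 u v <= 3 * r.
Proof.
  intros h; assert (h0 := h 0%nat); assert (h1 := h 1%nat).
  assert (h2 := h 2%nat).
  assert (hr : 0 <= r) by (eapply Rle_trans; [apply Rabs_pos | apply h0]).
  unfold dist3; apply norm_le_dot; [lra |].
  assert (sq : forall a, Rabs a <= r -> a * a <= r * r).
  { intros a ha; change (Rsqr a <= Rsqr r); apply Rsqr_le_abs_1.
    now rewrite (Rabs_pos_eq r). }
  apply sq in h0, h1, h2; revert h0 h1 h2; vec; intros; nra.
Qed.

Lemma normalize_val (v : R3) :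
  v <> zero -> S2val (normalize v) = scal (/ norm v) v.
Proof. intros h; unfold normalize; now destruct (R3_eq_dec v zero). Qed.

Lemma normalize_scal (r : R) (v : R3) :
  0 < r -> v <> zero -> normalize (scal r v) = normalize v.
Proof.
  intros hr hv; assert (hn := norm_pos v hv).
  assert (e : norm (scal r v) = r * norm v) by (apply norm_scal_pos; lra).
  assert (hrv : scal r v <> zero).
  { apply norm_neq0; rewrite e; nra. }
  apply S2_eq; rewrite !normalize_val, e; trivial.
  apply R3_ext; intros [| [| j]]; vec; field; lra.
Qed.

Lemma S2_dot (y : S2) : dot (S2val y) (S2val y) = 1.
Proof. rewrite <- norm_sqr; unfold S2val; rewrite (proj2_sig y); ring. Qed.

Lemma S2_dot_bound (y z : S2) : -1 <= dot (S2val y) (S2val z) <= 1.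
Proof.
  assert (h : forall y z, dot (S2val y) (S2val z) <= 1).
  { clear; intros y z; eapply Rle_trans; [apply dot_le_norm |].
    unfold S2val; rewrite (proj2_sig y), (proj2_sig z); lra. }
  split; [| apply h].
  assert (h' := h (antipode y) z).
  change (S2val (antipode y)) with (opp (S2val y)) in h'.
  rewrite dot_opp_l in h'; lra.
Qed.

(** * The projective plane *)

Lemma acos_decr (x y : R) : -1 <= x -> x <= y -> y <= 1 -> acos y <= acos x.
Proof.
  intros hx hxy hy.
  assert (bx := acos_bound x); assert (by' := acos_bound y).
  destruct (Rle_lt_dec (acos y) (acos x)) as [| h]; trivial.
  apply cos_decreasing_1 in h; try lra; rewrite !cos_acos in h; lra.
Qed.

(** Both distances entering the minimum are [acos] of opposite numbers, and
    [acos] is decreasing. *)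
Lemma dRP2_acos (y z : S2) :
  dRP2 (cls y) (cls z) = acos (Rabs (dot (S2val y) (S2val z))).
Proof.
  rewrite dRP2_cls; unfold dS2.
  change (S2val (antipode z)) with (opp (S2val z)); rewrite dot_opp_r.
  assert (h := S2_dot_bound y z); set (d := dot _ _) in *.
  unfold Rabs; destruct (Rcase_abs d).
  - apply Rmin_right, acos_decr; lra.
  - apply Rmin_left, acos_decr; lra.
Qed.

(** Unlike the arc cosine, the arc sine of the cross product is accurate for
    nearly parallel vectors: at small distances it is differentiable. *)
Lemma dRP2_asin (y z : S2) :
  dRP2 (cls y) (cls z) = asin (norm (cross (S2val y) (S2val z))).
Proof.
  rewrite dRP2_acos; assert (h := S2_dot_bound y z).
  assert (e : norm (cross (S2val y) (S2val z))
              = sqrt (1 - Rsqr (Rabs (dot (S2val y) (S2val z))))).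
  { rewrite norm_R3; f_equal; rewrite <- Rsqr_abs; unfold Rsqr.
    assert (hy := S2_dot y); assert (hz := S2_dot z).
    transitivity (dot (S2val y) (S2val y) * dot (S2val z) (S2val z)
                  - dot (S2val y) (S2val z) * dot (S2val y) (S2val z)).
    - destruct (S2val y) as [[y1 y2] y3], (S2val z) as [[z1 z2] z3].
      simpl; ring.
    - rewrite hy, hz; ring. }
  set (d := Rabs _) in *.
  assert (hd : 0 <= d <= 1).
  { split; [apply Rabs_pos | now apply Rabs_le]. }
  rewrite e, <- sin_acos by lra; symmetry; apply asin_sin.
  assert (b := acos_bound d).
  assert (h0 := acos_decr 0 d ltac:(lra) ltac:(lra) ltac:(lra)).
  rewrite acos_0 in h0; lra.
Qed.

Lemma RP2_ind_cls (p : RP2) : exists y, p = cls y.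
Proof. exists (repr p); symmetry; apply cls_repr. Qed.

Lemma dRP2_bounds (p q : RP2) : 0 <= dRP2 p q <= PI / 2.
Proof.
  destruct (RP2_ind_cls p) as [y ->], (RP2_ind_cls q) as [z ->].
  rewrite dRP2_acos; assert (h := S2_dot_bound y z); split.
  - apply acos_bound.
  - rewrite <- acos_0; apply acos_decr.
    + lra.
    + apply Rabs_pos.
    + now apply Rabs_le.
Qed.

(** [1 - cos x = 2 sin (x / 2) ^ 2], and the sine is below its argument. *)
Lemma one_minus_cos_le (x : R) : 0 <= x -> 2 - 2 * cos x <= x * x.
Proof.
  intros hx; replace x with (2 * (x / 2)) at 1 by field; rewrite cos_2a_sin.
  assert (h : Rabs (sin (x / 2)) <= x / 2).
  { apply Rabs_le; destruct hx as [hx | <-].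
    - assert (h1 := sin_lt_x (x / 2) ltac:(lra)).
      assert (hP := PI2_1); assert (b := SIN_bound (x / 2)).
      destruct (Rle_lt_dec (x / 2) 1) as [h2 | h2]; [| lra].
      assert (h3 := sin_ge_0 (x / 2) ltac:(lra) ltac:(lra)); lra.
    - replace (0 / 2) with 0 by field; rewrite sin_0; lra. }
  assert (h' : sin (x / 2) * sin (x / 2) <= x / 2 * (x / 2)).
  { apply Rsqr_le_abs_1; rewrite (Rabs_pos_eq (x / 2)); lra. }
  lra.
Qed.

Lemma chord_le_dS2 (y z : S2) : dist3 (S2val y) (S2val z) <= dS2 y z.
Proof.
  assert (b := acos_bound (dot (S2val y) (S2val z))).
  unfold dS2, dist3; apply norm_le_dot; [lra |].
  eapply Rle_trans; [| apply one_minus_cos_le; lra].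
  rewrite cos_acos by apply S2_dot_bound.
  apply Req_le; transitivity (dot (S2val y) (S2val y) + dot (S2val z) (S2val z)
                              - 2 * dot (S2val y) (S2val z)).
  - destruct (S2val y) as [[y1 y2] y3], (S2val z) as [[z1 z2] z3]; vec; ring.
  - rewrite !S2_dot; ring.
Qed.

(** Reduces estimates in the projective plane to estimates of chords, for which
    the triangle inequality is the one of the Euclidean space. *)
Lemma close_representative (y : S2) (q : RP2) :
  exists z, cls z = q /\ dist3 (S2val y) (S2val z) <= dRP2 (cls y) q.
Proof.
  destruct (RP2_ind_cls q) as [z ->]; rewrite dRP2_cls.
  destruct (Rle_dec (dS2 y z) (dS2 y (antipode z))) as [h | h].
  - exists z; split; trivial; rewrite Rmin_left; trivial; apply chord_le_dS2.
  - exists (antipode z); split; [apply cls_eq; now right |].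
    rewrite Rmin_right by lra; apply chord_le_dS2.
Qed.

(** If [y] were neither [v] nor its antipode, it would have a positive distance
    from both representatives. *)
Lemma cls_eq_limit (y v : S2) :
  (forall eps, 0 < eps ->
     exists z, cls z = cls v /\ dist3 (S2val y) (S2val z) < eps) ->
  cls y = cls v.
Proof.
  intros h; apply cls_eq.
  destruct (excluded_middle_informative (y = v)) as [| n1]; [now left |].
  destruct (excluded_middle_informative (y = antipode v)) as [| n2];
    [now right | exfalso].
  assert (p : forall z, y <> z -> 0 < dist3 (S2val y) (S2val z)).
  { intros z n; destruct (dist3_ge0 (S2val y) (S2val z)) as [| e]; trivial.
    exfalso; apply n, S2_eq, dist3_eq0; now symmetry. }
  destruct (h (Rmin (dist3 (S2val y) (S2val v))
                    (dist3 (S2val y) (S2val (antipode v))))) as [z [e hz]].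
  { apply Rmin_glb_lt; now apply p. }
  apply cls_eq in e.
  assert (l := Rmin_l (dist3 (S2val y) (S2val v))
                 (dist3 (S2val y) (S2val (antipode v)))).
  assert (r := Rmin_r (dist3 (S2val y) (S2val v))
                 (dist3 (S2val y) (S2val (antipode v)))).
  destruct e as [-> | ->]; lra.
Qed.

Lemma dRP2_refl (p : RP2) : dRP2 p p = 0.
Proof.
  destruct (RP2_ind_cls p) as [y ->]; rewrite dRP2_acos, S2_dot.
  rewrite Rabs_R1; apply acos_1.
Qed.

Lemma great_circle (e1 e2 : R3) (x : R) :
  dot e1 e1 = 1 -> dot e2 e2 = 1 -> dot e1 e2 = 0 ->
  norm (plus (scal (cos x) e1) (scal (sin x) e2)) = 1.
Proof.
  intros h1 h2 h12; apply norm_eq; [lra |].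
  assert (hcs := sin2_cos2 x); unfold Rsqr in hcs.
  transitivity (cos x * cos x * dot e1 e1 + sin x * sin x * dot e2 e2
                + 2 * cos x * sin x * dot e1 e2).
  - vec; ring.
  - rewrite h1, h2, h12; lra.
Qed.

(** On an interval not longer than [PI / 2] the scalar product, the cosine of the
    difference of the parameters, stays nonnegative: the antipode is never the
    closer representative. *)
Lemma great_circle_isometric (e1 e2 : R3) (g : R -> S2) (d : R) :
  dot e1 e1 = 1 -> dot e2 e2 = 1 -> dot e1 e2 = 0 -> d <= PI / 2 ->
  (forall x, S2val (g x) = plus (scal (cos x) e1) (scal (sin x) e2)) ->
  forall x y, 0 <= x <= d -> 0 <= y <= d ->
    dRP2 (cls (g x)) (cls (g y)) = Rabs (x - y).
Proof.
  intros h1 h2 h12 hd hg x y hx hy; rewrite dRP2_acos, !hg.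
  replace (dot _ _) with (cos (Rabs (x - y))).
  - assert (hP := PI_RGT_0).
    assert (hxy : 0 <= Rabs (x - y) <= PI / 2).
    { split; [apply Rabs_pos | apply Rabs_le; lra]. }
    rewrite Rabs_pos_eq; [apply acos_cos; lra | apply cos_ge_0; lra].
  - assert (e : cos (Rabs (x - y)) = cos (x - y)).
    { unfold Rabs; destruct (Rcase_abs _); trivial; apply cos_neg. }
    rewrite e, cos_minus; symmetry.
    transitivity (cos x * cos y * dot e1 e1 + sin x * sin y * dot e2 e2
                  + (cos x * sin y + sin x * cos y) * dot e1 e2).
    + vec; ring.
    + rewrite h1, h2, h12; ring.
Qed.

(** The representative of [q] in the closed hemisphere around [y] is reached by
    a great circle not longer than [PI / 2]. *)
Lemma minimal_geodesic (p q : RP2) :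
  exists g : R -> RP2, g 0 = p /\ g (dRP2 p q) = q /\
    forall x y, 0 <= x <= dRP2 p q -> 0 <= y <= dRP2 p q ->
      dRP2 (g x) (g y) = Rabs (x - y).
Proof.
  destruct (RP2_ind_cls p) as [y ->].
  assert (hz : exists z, cls z = q /\ 0 <= dot (S2val y) (S2val z)).
  { destruct (RP2_ind_cls q) as [z ->].
    destruct (Rle_lt_dec 0 (dot (S2val y) (S2val z))).
    - now exists z.
    - exists (antipode z); split; [apply cls_eq; now right |].
      change (S2val (antipode z)) with (opp (S2val z)).
      rewrite dot_opp_r; lra. }
  destruct hz as [z [<- hyz]].
  assert (hb := dRP2_bounds (cls y) (cls z)).
  assert (e : dRP2 (cls y) (cls z) = acos (dot (S2val y) (S2val z))).
  { rewrite dRP2_acos, Rabs_pos_eq; trivial. }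
  set (d := dRP2 (cls y) (cls z)) in *.
  assert (hcos : cos d = dot (S2val y) (S2val z)).
  { rewrite e; apply cos_acos, S2_dot_bound. }
  assert (hy := S2_dot y); assert (hz := S2_dot z).
  destruct (Req_dec d 0) as [h0 | h0].
  - exists (fun _ => cls y).
    split; [trivial |]; split.
    + assert (h1 : dist3 (S2val y) (S2val z) <= 0).
      { rewrite <- h0, e; apply chord_le_dS2. }
      assert (h2 := dist3_ge0 (S2val y) (S2val z)).
      f_equal; apply S2_eq, dist3_eq0; lra.
    + intros x x' hx hx'; rewrite dRP2_refl; replace (x - x') with 0 by lra.
      now rewrite Rabs_R0.
  - assert (hP := PI_RGT_0); assert (hs : 0 < sin d) by (apply sin_gt_0; lra).
    assert (hcs := sin2_cos2 d); unfold Rsqr in hcs.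
    set (e1 := S2val y).
    (* the unit tangent at [y] of the great circle towards [z] *)
    set (e2 := scal (/ sin d) (minus (S2val z) (scal (cos d) (S2val y))) : R3).
    assert (h12 : dot e1 e2 = 0).
    { unfold e1, e2.
      transitivity (/ sin d * (dot (S2val y) (S2val z)
                               - cos d * dot (S2val y) (S2val y))).
      - destruct (S2val y) as [[y1 y2] y3], (S2val z) as [[z1 z2] z3]; vec; ring.
      - rewrite hy, hcos; ring. }
    assert (h2 : dot e2 e2 = 1).
    { unfold e2.
      transitivity (/ sin d * / sin d *
        (dot (S2val z) (S2val z) - 2 * cos d * dot (S2val y) (S2val z)
         + cos d * cos d * dot (S2val y) (S2val y))).
      - destruct (S2val y) as [[y1 y2] y3], (S2val z) as [[z1 z2] z3]; vec; ring.
      - rewrite hy, hz, <- hcos.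
        replace (1 - 2 * cos d * cos d + cos d * cos d * 1)
          with (sin d * sin d) by lra.
        field; lra. }
    set (g := fun x => exist (fun v : R3 => norm v = 1) _
                         (great_circle e1 e2 x hy h2 h12) : S2).
    exists (fun x => cls (g x)); split; [| split].
    + f_equal; apply S2_eq; unfold g, e1; simpl; rewrite cos_0, sin_0.
      destruct e2 as [[a b] c]; clear.
      apply R3_ext; intros [| [| j]]; destruct (S2val y) as [[y1 y2] y3];
        vec; ring.
    + f_equal; apply S2_eq; unfold g, e1, e2; simpl.
      apply R3_ext; intros [| [| j]]; destruct (S2val y) as [[y1 y2] y3],
        (S2val z) as [[z1 z2] z3]; vec; field; lra.
    + apply (great_circle_isometric e1 e2 g d); trivial; lra.
Qed.

(** * Derivatives relative to an interval *)

(** One-sided at the end points, as is the derivative within an interval. *)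
Definition rel_derive (a b : R) (f : R -> R) (s l : R) : Prop :=
  forall eps, 0 < eps -> exists d, 0 < d /\
    forall y, a <= y <= b -> Rabs (y - s) < d ->
      Rabs (f y - f s - (y - s) * l) <= eps * Rabs (y - s).

Definition rel_continuous (a b : R) (f : R -> R) : Prop :=
  forall s, a <= s <= b -> forall eps, 0 < eps -> exists d, 0 < d /\
    forall y, a <= y <= b -> Rabs (y - s) < d -> Rabs (f y - f s) < eps.

Lemma is_derive_in_coord (a b : R) (f : R -> R3) (s : R) (l : R3) (j : nat) :
  a <= s <= b -> is_derive_in a b f s l ->
  rel_derive a b (fun x => coord j (f x)) s (coord j l).
Proof.
  intros hs [_ h] eps heps.
  assert (hl : is_filter_lim
                 (within (fun x => a <= x <= b) (locally s)) s).
  { intros P [e he]; exists e; intros y hy _; now apply he. }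
  destruct (h s hl (mkposreal eps heps)) as [d hd].
  exists d; split; [apply cond_pos |]; intros y hy hys.
  specialize (hd y hys hy); simpl in hd.
  eapply Rle_trans; [| apply hd].
  eapply Rle_trans; [| apply (coord_le_norm j)].
  apply Req_le; f_equal; clear.
  change (minus y s) with (y - s).
  destruct j as [| [| j]]; destruct (f y) as [[u1 u2] u3],
    (f s) as [[v1 v2] v3], l as [[l1 l2] l3]; vec; ring.
Qed.

Lemma continuous_on_coord (a b : R) (f : R -> R3) (j : nat) :
  continuous_on (fun x => a <= x <= b) f ->
  rel_continuous a b (fun x => coord j (f x)).
Proof.
  intros h s hs eps heps.
  destruct (proj1 (filterlim_locally _ _) (h s hs) (mkposreal eps heps))
    as [d hd].
  exists d; split; [apply cond_pos |]; intros y hy hys.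
  specialize (hd y hys hy); simpl in hd; revert hd.
  destruct (f y) as [[u1 u2] u3], (f s) as [[v1 v2] v3].
  intros [[h1 h2] h3]; destruct j as [| [| j]]; trivial.
Qed.

Lemma rel_derive_minus (a b : R) (f g : R -> R) (s l m : R) :
  rel_derive a b f s l -> rel_derive a b g s m ->
  rel_derive a b (fun x => f x - g x) s (l - m).
Proof.
  intros hf hg eps heps.
  destruct (hf (eps / 2) ltac:(lra)) as [d1 [p1 h1]].
  destruct (hg (eps / 2) ltac:(lra)) as [d2 [p2 h2]].
  exists (Rmin d1 d2); split; [now apply Rmin_glb_lt |].
  intros y hy hys.
  assert (l1 := Rmin_l d1 d2); assert (l2 := Rmin_r d1 d2).
  specialize (h1 y hy ltac:(lra)); specialize (h2 y hy ltac:(lra)).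
  replace (f y - g y - (f s - g s) - (y - s) * (l - m))
    with ((f y - f s - (y - s) * l) - (g y - g s - (y - s) * m)) by ring.
  eapply Rle_trans; [apply Rabs_triang |]; rewrite Rabs_Ropp; lra.
Qed.

Lemma rel_derive_of_derive (a b : R) (f : R -> R) (s l : R) :
  is_derive f s l -> rel_derive a b f s l.
Proof.
  intros [_ h] eps heps.
  destruct (h s (fun P hP => hP) (mkposreal eps heps)) as [d hd].
  exists d; split; [apply cond_pos |]; intros y hy hys.
  exact (hd y hys).
Qed.

(** An interval of positive length contains points [y <> s] on at least one side
    of [s]. *)
Lemma rel_derive_unique (a b : R) (f : R -> R) (s l m : R) :
  a < b -> a <= s <= b -> rel_derive a b f s l -> rel_derive a b f s m -> l = m.
Proof.
  intros hab hs hl hm.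
  apply cond_eq; intros eps heps.
  destruct (hl (eps / 4) ltac:(lra)) as [d1 [p1 h1]].
  destruct (hm (eps / 4) ltac:(lra)) as [d2 [p2 h2]].
  assert (hy : exists y, a <= y <= b /\ y <> s /\ Rabs (y - s) < d1
                         /\ Rabs (y - s) < d2).
  { set (d := Rmin (Rmin d1 d2) (b - a)).
    assert (hd : 0 < d) by (repeat apply Rmin_glb_lt; lra).
    assert (e1 : d <= Rmin d1 d2) by apply Rmin_l.
    assert (e2 : d <= b - a) by apply Rmin_r.
    assert (l1 := Rmin_l d1 d2); assert (l2 := Rmin_r d1 d2).
    destruct (Rle_lt_dec s ((a + b) / 2)).
    - exists (s + d / 2); rewrite Rabs_pos_eq by lra; repeat split; lra.
    - exists (s - d / 2); rewrite Rabs_left1 by lra; repeat split; lra. }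
  destruct hy as [y [hy [n [y1 y2]]]].
  specialize (h1 y hy y1); specialize (h2 y hy y2).
  assert (hp : 0 < Rabs (y - s)) by (apply Rabs_pos_lt; lra).
  apply Rmult_lt_reg_r with (Rabs (y - s)); trivial.
  rewrite <- Rabs_mult.
  replace ((l - m) * (y - s)) with
    ((f y - f s - (y - s) * m) - (f y - f s - (y - s) * l)) by ring.
  eapply Rle_lt_trans; [apply Rabs_triang |]; rewrite Rabs_Ropp; nra.
Qed.

Definition clamp (a b x : R) : R := Rmax a (Rmin b x).

Lemma clamp_in (a b x : R) : a <= b -> a <= clamp a b x <= b.
Proof.
  intros h; unfold clamp, Rmax, Rmin.
  destruct (Rle_dec b x), (Rle_dec a _); lra.
Qed.

Lemma clamp_id (a b x : R) : a <= x <= b -> clamp a b x = x.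
Proof.
  intros h; unfold clamp, Rmax, Rmin.
  destruct (Rle_dec b x), (Rle_dec a _); lra.
Qed.

Lemma clamp_below (a b x : R) : a <= b -> x <= a -> clamp a b x = a.
Proof.
  intros h hx; unfold clamp, Rmax, Rmin.
  destruct (Rle_dec b x), (Rle_dec a _); lra.
Qed.

Lemma clamp_above (a b x : R) : a <= b -> b <= x -> clamp a b x = b.
Proof.
  intros h hx; unfold clamp, Rmax, Rmin.
  destruct (Rle_dec b x), (Rle_dec a _); lra.
Qed.

Lemma clamp_lipschitz (a b x y : R) :
  a <= b -> Rabs (clamp a b x - clamp a b y) <= Rabs (x - y).
Proof.
  intros h; unfold clamp, Rmax, Rmin, Rabs.
  destruct (Rle_dec b x), (Rle_dec b y); repeat destruct (Rle_dec a _);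
    repeat destruct (Rcase_abs _); lra.
Qed.

Lemma continuous_clamp (a b : R) (f : R -> R) :
  a <= b -> rel_continuous a b f ->
  forall x, continuous (fun x => f (clamp a b x)) x.
Proof.
  intros hab hf x; apply filterlim_locally; intros eps.
  destruct (hf (clamp a b x) (clamp_in a b x hab) eps (cond_pos eps))
    as [d [hd h]].
  exists (mkposreal d hd); intros y hy; apply h; [now apply clamp_in |].
  eapply Rle_lt_trans; [now apply clamp_lipschitz | exact hy].
Qed.

Lemma rel_derive_continuous (a b : R) (f f' : R -> R) :
  (forall s, a <= s <= b -> rel_derive a b f s (f' s)) -> rel_continuous a b f.
Proof.
  intros h s hs eps heps.
  destruct (h s hs 1 Rlt_0_1) as [d [hd hd']].
  set (k := Rabs (f' s) + 1).
  assert (hk : 0 < k) by (assert (e := Rabs_pos (f' s)); unfold k; lra).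
  exists (Rmin d (eps / k)); split.
  { apply Rmin_glb_lt; trivial; now apply Rdiv_lt_0_compat. }
  intros y hy hys.
  assert (l1 := Rmin_l d (eps / k)); assert (l2 := Rmin_r d (eps / k)).
  specialize (hd' y hy ltac:(lra)).
  assert (hlt : Rabs (y - s) * k < eps).
  { apply Rlt_le_trans with (eps / k * k); [| right; field; lra].
    apply Rmult_lt_compat_r; lra. }
  replace (f y - f s) with ((f y - f s - (y - s) * f' s) + (y - s) * f' s)
    by ring.
  eapply Rle_lt_trans; [apply Rabs_triang |]; rewrite Rabs_mult.
  unfold k in hlt; lra.
Qed.

(** Precomposing with [clamp] makes the function continuous on the line without
    changing its derivative inside, so that the classical mean value theorem
    applies. *)
Lemma rel_MVT (a b : R) (f f' : R -> R) (x y : R) :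
  (forall s, a <= s <= b -> rel_derive a b f s (f' s)) ->
  a <= x -> x <= y -> y <= b ->
  exists z, x <= z <= y /\ f y - f x = f' z * (y - x).
Proof.
  intros h hx hxy hy.
  assert (hc := continuous_clamp a b f ltac:(lra)
                  (rel_derive_continuous a b f f' h)).
  destruct (MVT_gen (fun x => f (clamp a b x)) x y f') as [z [hz e]].
  - rewrite Rmin_left, Rmax_right by trivial; intros z hz.
    apply is_derive_ext_loc with f.
    { assert (hp : 0 < Rmin (z - a) (b - z)) by (apply Rmin_glb_lt; lra).
      exists (mkposreal _ hp); intros w hw; symmetry; f_equal; apply clamp_id.
      change (Rabs (w - z) < Rmin (z - a) (b - z)) in hw.
      assert (l1 := Rmin_l (z - a) (b - z)).
      assert (l2 := Rmin_r (z - a) (b - z)).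
      apply Rabs_def2 in hw; lra. }
    split; [apply is_linear_scal_l |].
    intros w hw; apply (is_filter_lim_locally_unique z w) in hw.
    subst w; intros eps.
    destruct (h z ltac:(lra) eps (cond_pos eps)) as [d [hd hd']].
    assert (hp : 0 < Rmin d (Rmin (z - a) (b - z)))
      by (repeat apply Rmin_glb_lt; lra).
    exists (mkposreal _ hp); intros w hw.
    change (Rabs (w - z) < Rmin d (Rmin (z - a) (b - z))) in hw.
    assert (l0 := Rmin_l d (Rmin (z - a) (b - z))).
    assert (l3 := Rmin_r d (Rmin (z - a) (b - z))).
    assert (l1 := Rmin_l (z - a) (b - z)).
    assert (l2 := Rmin_r (z - a) (b - z)).
    apply hd'; [apply Rabs_def2 in hw; lra | lra].
  - intros z hz; apply continuity_pt_filterlim, hc.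
  - rewrite Rmin_left, Rmax_right in hz by trivial.
    rewrite !clamp_id in e by lra; now exists z.
Qed.

Lemma rel_derive_determines (a b : R) (f g f' : R -> R) :
  (forall s, a <= s <= b -> rel_derive a b f s (f' s)) ->
  (forall s, a <= s <= b -> rel_derive a b g s (f' s)) ->
  f a = g a -> forall s, a <= s <= b -> f s = g s.
Proof.
  intros hf hg e s hs.
  destruct (rel_MVT a b (fun x => f x - g x) (fun x => f' x - f' x) a s)
    as [z [_ hz]]; try lra.
  intros x hx; apply rel_derive_minus; auto.
Qed.

(** * Extension of the curve to the whole line *)

(** Adding the two clamped copies makes the seam at [L] invisible as soon as
    the values at the end points agree. *)
Lemma continuous_extension (L : R) (f : R -> R) :
  0 < L -> rel_continuous 0 L f ->
  exists g : R -> R, (forall x, continuous g x) /\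
    (forall x, 0 <= x <= L -> g x = f x) /\
    (f 0 = f L -> forall x, 0 <= x <= L -> g (x + L) = f x).
Proof.
  intros hL hf; set (k := fun x => f (clamp 0 L x)).
  assert (hk := continuous_clamp 0 L f ltac:(lra) hf).
  exists (fun x => k x + k (x - L) - f 0); repeat split.
  - intros x; apply (continuous_minus (fun x => k x + k (x - L)) (fun _ => f 0)).
    + apply (continuous_plus k (fun x => k (x - L))); [apply hk |].
      apply (continuous_comp (fun x => x - L) k); [| apply hk].
      apply (continuous_minus (fun x => x) (fun _ => L));
        [apply continuous_id | apply continuous_const].
    + apply continuous_const.
  - intros x hx; unfold k; rewrite clamp_id by trivial.
    rewrite clamp_below by lra; ring.
  - intros e x hx; unfold k; rewrite clamp_above by lra.
    rewrite clamp_id by lra; replace (x + L - L) with x by ring; lra.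
Qed.

Lemma RInt_derive (g : R -> R) (a x : R) :
  (forall x, continuous g x) -> is_derive (fun x => RInt g a x) x (g x).
Proof.
  intros hg; apply is_derive_RInt with a; [| apply hg].
  exists (mkposreal 1 Rlt_0_1); intros y _.
  apply (RInt_correct (V := R_CompleteNormedModule)).
  apply (ex_RInt_continuous (V := R_CompleteNormedModule)); intros; apply hg.
Qed.

(** Integrating the extension of the derivative extends the function, and keeps
    the periodicity if the end values agree. *)
Lemma derivable_extension (L : R) (f f' g' : R -> R) :
  0 < L -> (forall s, 0 <= s <= L -> rel_derive 0 L f s (f' s)) ->
  (forall x, continuous g' x) ->
  (forall x, 0 <= x <= L -> g' x = f' x) ->
  exists g : R -> R, (forall x, is_derive g x (g' x)) /\
    (forall x, 0 <= x <= L -> g x = f x) /\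
    (f 0 = f L -> (forall x, 0 <= x <= L -> g' (x + L) = f' x) ->
     forall x, 0 <= x <= L -> g (x + L) = f x).
Proof.
  intros hL hf hg' e; set (g := fun x => f 0 + RInt g' 0 x).
  assert (hg : forall x, is_derive g x (g' x))
    by (intros x; rewrite <- (Rplus_0_l (g' x));
        apply (is_derive_plus (fun _ => f 0) (fun x => RInt g' 0 x));
        [apply @is_derive_const | now apply RInt_derive]).
  assert (hgf : forall x, 0 <= x <= L -> g x = f x).
  { apply (rel_derive_determines 0 L g f f'); trivial.
    - intros s hs; rewrite <- e by trivial; now apply rel_derive_of_derive.
    - unfold g; rewrite RInt_point; apply Rplus_0_r. }
  exists g; split; [trivial | split; [trivial |]].
  intros h0 hs; apply (rel_derive_determines 0 L (fun x => g (x + L)) f f');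
    trivial.
  - intros s hs'; rewrite <- hs by trivial; apply rel_derive_of_derive.
    replace (g' (s + L)) with (1 * g' (s + L)) by ring.
    apply (is_derive_comp g (fun x => x + L)); [apply hg |].
    replace 1 with (1 + 0) by ring.
    apply (is_derive_plus (fun x => x) (fun _ => L));
      [apply @is_derive_id | apply @is_derive_const].
  - rewrite Rplus_0_l, hgf by lra; lra.
Qed.

Definition is_C3 (C C1 C2 C3 : R -> R3) : Prop :=
  forall j x, is_derive (fun t => coord j (C t)) x (coord j (C1 x)) /\
    is_derive (fun t => coord j (C1 t)) x (coord j (C2 x)) /\
    is_derive (fun t => coord j (C2 t)) x (coord j (C3 x)) /\
    continuous (fun t => coord j (C3 t)) x.

Definition shift_agrees (L : R) (C c : R -> R3) : Prop :=
  forall x, 0 <= x <= L -> C (x + L) = c x.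

(** Extend the third derivative and integrate three times. The extension gives
    two-sided derivatives at the end points and, for a closed curve, room for the
    segments that follow the seam. *)
Lemma C3_extension (L : R) (c c1 c2 c3 : R -> R3) :
  0 < L -> class_C3 0 L c c1 c2 c3 ->
  exists C C1 C2 C3 : R -> R3, is_C3 C C1 C2 C3 /\
    (forall x, 0 <= x <= L ->
       C x = c x /\ C1 x = c1 x /\ C2 x = c2 x /\ C3 x = c3 x) /\
    (closes_C3 0 L c c1 c2 c3 ->
       shift_agrees L C c /\ shift_agrees L C1 c1 /\ shift_agrees L C2 c2).
Proof.
  intros hL [hd hc3].
  assert (H : forall j, exists g g1 g2 g3 : R -> R,
    (forall x, is_derive g x (g1 x) /\ is_derive g1 x (g2 x) /\
               is_derive g2 x (g3 x) /\ continuous g3 x) /\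
    (forall x, 0 <= x <= L -> g x = coord j (c x) /\ g1 x = coord j (c1 x) /\
               g2 x = coord j (c2 x) /\ g3 x = coord j (c3 x)) /\
    (closes_C3 0 L c c1 c2 c3 -> forall x, 0 <= x <= L ->
       g (x + L) = coord j (c x) /\ g1 (x + L) = coord j (c1 x) /\
       g2 (x + L) = coord j (c2 x))).
  { intros j.
    destruct (continuous_extension L (fun x => coord j (c3 x)) hL)
      as [g3 [k3 [e3 p3]]]; [now apply continuous_on_coord |].
    destruct (derivable_extension L (fun x => coord j (c2 x))
      (fun x => coord j (c3 x)) g3 hL) as [g2 [k2 [e2 p2]]]; trivial.
    { intros s hs; apply is_derive_in_coord; trivial; now apply hd. }
    destruct (derivable_extension L (fun x => coord j (c1 x))
      (fun x => coord j (c2 x)) g2 hL) as [g1 [k1 [e1 p1]]]; trivial.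
    { intros s hs; apply is_derive_in_coord; trivial; now apply hd. }
    { intros x; apply (ex_derive_continuous g2); now exists (g3 x). }
    destruct (derivable_extension L (fun x => coord j (c x))
      (fun x => coord j (c1 x)) g1 hL) as [g [k [e p]]]; trivial.
    { intros s hs; apply is_derive_in_coord; trivial; now apply hd. }
    { intros x; apply (ex_derive_continuous g1); now exists (g2 x). }
    exists g, g1, g2, g3; split; [| split].
    - intros x; auto.
    - intros x hx; auto.
    - intros [h0 [h1 [h2 h3]]] x hx.
      assert (q3 := p3 ltac:(simpl; congruence)).
      assert (q2 := p2 ltac:(simpl; congruence) q3).
      assert (q1 := p1 ltac:(simpl; congruence) q2).
      assert (q := p ltac:(simpl; congruence) q1); auto. }
  destruct (H 0%nat) as [a [a1 [a2 [a3 [da [ea pa]]]]]].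
  destruct (H 1%nat) as [b [b1 [b2 [b3 [db [eb pb]]]]]].
  destruct (H 2%nat) as [d [d1 [d2 [d3 [dd [ed pd]]]]]].
  exists (fun x => (a x, b x, d x)), (fun x => (a1 x, b1 x, d1 x)),
    (fun x => (a2 x, b2 x, d2 x)), (fun x => (a3 x, b3 x, d3 x)).
  split; [| split].
  - intros j x; destruct j as [| [| j]]; simpl; auto.
  - intros x hx; destruct (ea x hx) as [-> [-> [-> ->]]].
    destruct (eb x hx) as [-> [-> [-> ->]]].
    destruct (ed x hx) as [-> [-> [-> ->]]].
    now destruct (c x) as [[? ?] ?], (c1 x) as [[? ?] ?], (c2 x) as [[? ?] ?],
      (c3 x) as [[? ?] ?].
  - intros h; assert (hh : forall x, 0 <= x <= L ->
      (a (x + L), b (x + L), d (x + L)) = c x /\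
      (a1 (x + L), b1 (x + L), d1 (x + L)) = c1 x /\
      (a2 (x + L), b2 (x + L), d2 (x + L)) = c2 x).
    { intros x hx; destruct (pa h x hx) as [-> [-> ->]].
      destruct (pb h x hx) as [-> [-> ->]].
      destruct (pd h x hx) as [-> [-> ->]].
      now destruct (c x) as [[? ?] ?], (c1 x) as [[? ?] ?],
        (c2 x) as [[? ?] ?]. }
    repeat split; intros x hx; now apply hh.
Qed.

(** * Divided differences *)

Definition dd1 (f : R -> R) (x y : R) : R := (f y - f x) / (y - x).
Definition dd2 (f : R -> R) (x y z : R) : R := (dd1 f y z - dd1 f x y) / (z - x).
Definition dd3 (f : R -> R) (x y z w : R) : R :=
  (dd2 f y z w - dd2 f x y z) / (w - x).

Lemma rolle (f f' : R -> R) (x y : R) :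
  (forall t, is_derive f t (f' t)) -> x < y -> f x = f y ->
  exists z, x < z < y /\ f' z = 0.
Proof.
  intros h hxy e.
  destruct (MVT_cor2 f f' x y hxy) as [z [hz hz']].
  - intros c _; now apply is_derive_Reals.
  - exists z; split; trivial; rewrite e in hz.
    apply Rmult_eq_reg_r with (y - x); lra.
Qed.

(** The vanishing cubic term makes the derivative an instance of the same form,
    so that the lemma can be iterated. *)
Lemma minus_cubic_derive (f f' : R -> R) (a b c d x : R) :
  is_derive f x (f' x) ->
  is_derive (fun t => f t - (a + b * t + c * t ^ 2 + d * t ^ 3)) x
    (f' x - (b + 2 * c * x + 3 * d * x ^ 2 + 0 * x ^ 3)).
Proof.
  intros h; apply (is_derive_minus f); trivial; auto_derive; trivial; ring.
Qed.

Lemma dd1_mean (f f1 : R -> R) (x y : R) :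
  (forall t, is_derive f t (f1 t)) -> x < y ->
  exists z, x < z < y /\ dd1 f x y = f1 z.
Proof.
  intros h hxy.
  destruct (MVT_cor2 f f1 x y hxy) as [z [e hz]].
  - intros c _; now apply is_derive_Reals.
  - exists z; split; trivial; unfold dd1; rewrite e; field; lra.
Qed.

Lemma dd2_mean (f f1 f2 : R -> R) (x y z : R) :
  (forall t, is_derive f t (f1 t)) -> (forall t, is_derive f1 t (f2 t)) ->
  x < y -> y < z -> exists w, x < w < z /\ dd2 f x y z = f2 w / 2.
Proof.
  intros h h1 hxy hyz.
  (* the coefficients of the quadratic interpolant in the monomial basis *)
  set (c := dd2 f x y z); set (b := dd1 f x y - c * (x + y)).
  set (a := f x - b * x - c * x ^ 2).
  set (g := fun t => f t - (a + b * t + c * t ^ 2 + 0 * t ^ 3)).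
  assert (hg := fun t => minus_cubic_derive f f1 a b c 0 t (h t)).
  assert (gx : g x = 0) by (unfold g, a; ring).
  assert (gy : g y = 0) by (unfold g, a, b, dd1; field; lra).
  assert (gz : g z = 0)
    by (unfold g, a, b, c, dd2, dd1; field; repeat split; lra).
  destruct (rolle g _ x y hg hxy ltac:(congruence)) as [u [hu eu]].
  destruct (rolle g _ y z hg hyz ltac:(congruence)) as [v [hv ev]].
  assert (hg1 := fun t => minus_cubic_derive f1 f2 b (2 * c) (3 * 0) 0 t (h1 t)).
  destruct (rolle _ _ u v hg1) as [w [hw ew]]; [lra | lra |].
  exists w; split; lra.
Qed.

(** Subtracting the cubic interpolant leaves four zeros; by the theorem of Rolle
    the third derivative of the difference vanishes somewhere between them. *)
Lemma dd3_mean (f f1 f2 f3 : R -> R) (x y z w : R) :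
  (forall t, is_derive f t (f1 t)) -> (forall t, is_derive f1 t (f2 t)) ->
  (forall t, is_derive f2 t (f3 t)) -> x < y -> y < z -> z < w ->
  exists u, x < u < w /\ dd3 f x y z w = f3 u / 6.
Proof.
  intros h h1 h2 hxy hyz hzw.
  (* the coefficients of the cubic interpolant in the monomial basis *)
  set (d := dd3 f x y z w); set (c := dd2 f x y z - d * (x + y + z)).
  set (b := dd1 f x y - dd2 f x y z * (x + y) + d * (x * y + x * z + y * z)).
  set (a := f x - b * x - c * x ^ 2 - d * x ^ 3).
  set (g := fun t => f t - (a + b * t + c * t ^ 2 + d * t ^ 3)).
  assert (hg := fun t => minus_cubic_derive f f1 a b c d t (h t)).
  assert (gx : g x = 0) by (unfold g, a; ring).
  assert (gy : g y = 0) by (unfold g, a, b, c, dd1; field; lra).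
  assert (gz : g z = 0)
    by (unfold g, a, b, c, dd2, dd1; field; repeat split; lra).
  assert (gw : g w = 0)
    by (unfold g, a, b, c, d, dd3, dd2, dd1; field; repeat split; lra).
  destruct (rolle g _ x y hg hxy ltac:(congruence)) as [p [hp ep]].
  destruct (rolle g _ y z hg hyz ltac:(congruence)) as [q [hq eq]].
  destruct (rolle g _ z w hg hzw ltac:(congruence)) as [r [hr er]].
  assert (hg1 := fun t =>
    minus_cubic_derive f1 f2 b (2 * c) (3 * d) 0 t (h1 t)).
  destruct (rolle _ _ p q hg1) as [s [hs es]]; [lra | lra |].
  destruct (rolle _ _ q r hg1) as [t [ht et]]; [lra | lra |].
  assert (hg2 := fun t =>
    minus_cubic_derive f2 f3 (2 * c) (2 * (3 * d)) (3 * 0) 0 t (h2 t)).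
  destruct (rolle _ _ s t hg2) as [u [hu eu]]; [lra | lra |].
  exists u; split; lra.
Qed.

(** * Limits along quadruples of nodes *)

Lemma near4_inhabited (x d : R) : 0 < d -> exists x0 x1 x2 x3 : R,
  x - d < x0 /\ x0 < x1 /\ x1 < x2 /\ x2 < x3 /\ x3 < x + d.
Proof.
  intros hd; exists (x - d / 2), (x - d / 3), (x + d / 3), (x + d / 2).
  repeat split; lra.
Qed.

Record nodes4 : Type := Nodes4 { n0 : R; n1 : R; n2 : R; n3 : R }.

(** The increasing quadruples that shrink to [x]; nothing is asked of the ratios
    of the three gaps. *)
Definition near4 (x : R) (P : nodes4 -> Prop) : Prop :=
  exists d, 0 < d /\ forall x0 x1 x2 x3,
    x - d < x0 -> x0 < x1 -> x1 < x2 -> x2 < x3 -> x3 < x + d ->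
    P (Nodes4 x0 x1 x2 x3).

Global Instance near4_filter (x : R) : ProperFilter (near4 x).
Proof.
  split; [| split].
  - intros P [d [hd h]].
    destruct (near4_inhabited x d hd) as [x0 [x1 [x2 [x3 [? [? [? []]]]]]]].
    exists (Nodes4 x0 x1 x2 x3); auto.
  - exists 1; split; [lra | trivial].
  - intros P Q [d [hd h]] [e [he k]]; exists (Rmin d e); split.
    + now apply Rmin_glb_lt.
    + assert (l1 := Rmin_l d e); assert (l2 := Rmin_r d e).
      intros; split; [apply h | apply k]; trivial; lra.
  - intros P Q i [d [hd h]]; exists d; split; auto.
Qed.

Section Limits.

Context {X : Type} (F : (X -> Prop) -> Prop) {FF : Filter F}.

Definition limF (f : X -> R) (l : R) : Prop := filterlim f F (locally l).

Lemma limF_iff (f : X -> R) (l : R) :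
  limF f l <-> forall eps, 0 < eps -> F (fun q => Rabs (f q - l) < eps).
Proof.
  unfold limF; rewrite filterlim_locally; split.
  - intros h eps heps; exact (h (mkposreal eps heps)).
  - intros h eps; exact (h eps (cond_pos eps)).
Qed.

Lemma limF_const (l : R) : limF (fun _ => l) l.
Proof. apply filterlim_const. Qed.

Lemma limF_comp (f : X -> R) (g : R -> R) (l : R) :
  limF f l -> continuous g l -> limF (fun q => g (f q)) (g l).
Proof. intros hf hg; now apply (filterlim_comp _ _ _ f g _ (locally l)). Qed.

Lemma limF_plus (f g : X -> R) (l m : R) :
  limF f l -> limF g m -> limF (fun q => f q + g q) (l + m).
Proof.
  intros hf hg; apply (filterlim_comp_2 f g _ hf hg).
  apply (filterlim_plus (V := R_NormedModule)).
Qed.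

Lemma limF_mult (f g : X -> R) (l m : R) :
  limF f l -> limF g m -> limF (fun q => f q * g q) (l * m).
Proof.
  intros hf hg; apply (filterlim_comp_2 f g _ hf hg).
  apply (filterlim_mult (K := R_AbsRing)).
Qed.

Lemma limF_minus (f g : X -> R) (l m : R) :
  limF f l -> limF g m -> limF (fun q => f q - g q) (l - m).
Proof.
  intros hf hg; apply limF_plus; trivial.
  apply (limF_comp g Ropp); trivial.
  apply (continuous_opp (fun x : R => x)), continuous_id.
Qed.

Lemma limF_div (f g : X -> R) (l m : R) :
  limF f l -> limF g m -> m <> 0 -> limF (fun q => f q / g q) (l / m).
Proof.
  intros hf hg hm; apply limF_mult; trivial.
  apply (limF_comp g Rinv); trivial.
  now apply continuous_Rinv.
Qed.

Definition vlimF (f : X -> R3) (l : R3) : Prop :=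
  forall j, limF (fun q => coord j (f q)) (coord j l).

Lemma limF_ext (f g : X -> R) (l m : R) :
  (forall q, f q = g q) -> l = m -> limF f l -> limF g m.
Proof. intros e <-; now apply filterlim_ext. Qed.

Lemma limF_dot (f g : X -> R3) (l m : R3) :
  vlimF f l -> vlimF g m -> limF (fun q => dot (f q) (g q)) (dot l m).
Proof.
  intros hf hg; eapply limF_ext; [| |
    apply limF_plus; [apply limF_plus |]; apply limF_mult;
      [apply (hf 0%nat) | apply (hg 0%nat) | apply (hf 1%nat)
      | apply (hg 1%nat) | apply (hf 2%nat) | apply (hg 2%nat)]].
  - intros q; simpl; now destruct (f q) as [[? ?] ?], (g q) as [[? ?] ?].
  - now destruct l as [[? ?] ?], m as [[? ?] ?].
Qed.

Lemma vlimF_cross (f g : X -> R3) (l m : R3) :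
  vlimF f l -> vlimF g m -> vlimF (fun q => cross (f q) (g q)) (cross l m).
Proof.
  intros hf hg j.
  assert (H : forall i k, limF
    (fun q => coord i (f q) * coord k (g q) - coord k (f q) * coord i (g q))
    (coord i l * coord k m - coord k l * coord i m)).
  { intros i k; apply limF_minus; apply limF_mult; auto. }
  destruct j as [| [| j]];
    [apply (limF_ext _ _ _ _) with (3 := H 1%nat 2%nat)
    | apply (limF_ext _ _ _ _) with (3 := H 2%nat 0%nat)
    | apply (limF_ext _ _ _ _) with (3 := H 0%nat 1%nat)];
    try (intros q; now destruct (f q) as [[? ?] ?], (g q) as [[? ?] ?]);
    now destruct l as [[? ?] ?], m as [[? ?] ?].
Qed.

Lemma limF_norm (f : X -> R3) (l : R3) :
  vlimF f l -> limF (fun q => norm (f q)) (norm l).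
Proof.
  intros hf; eapply limF_ext; [| |
    apply (limF_comp (fun q => dot (f q) (f q)) sqrt);
      [now apply limF_dot | apply continuous_sqrt]].
  - intros q; symmetry; apply norm_R3.
  - symmetry; apply norm_R3.
Qed.

(** The first conclusion keeps the dummy value of [normalize] at the origin out
    of the limit. *)
Lemma vlimF_normalize (f : X -> R3) (l : R3) :
  vlimF f l -> l <> zero ->
  F (fun q => f q <> zero) /\
  vlimF (fun q => S2val (normalize (f q))) (S2val (normalize l)).
Proof.
  intros hf hl; assert (hn := norm_pos l hl); assert (hfn := limF_norm f l hf).
  assert (hz : F (fun q => f q <> zero)).
  { apply (proj1 (limF_iff _ _)) with (eps := norm l) in hfn; trivial.
    revert hfn; apply filter_imp; intros q h e.
    rewrite e, norm_0 in h; apply Rabs_def2 in h; lra. }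
  split; trivial; intros j.
  assert (H : limF (fun q => coord j (f q) / norm (f q)) (coord j l / norm l))
    by (apply limF_div; [apply hf | trivial | lra]).
  assert (E : forall v : R3, v <> zero ->
                coord j (S2val (normalize v)) = coord j v / norm v).
  { intros v hv; rewrite normalize_val by trivial.
    unfold Rdiv; generalize (/ norm v); intros r; clear.
    destruct j as [| [| j]]; vec; ring. }
  rewrite E by trivial; revert H; apply filterlim_ext_loc.
  revert hz; apply filter_imp; intros q hq; now rewrite E.
Qed.

End Limits.

Lemma near4_point (x : R) (f : nodes4 -> R) :
  (forall q, n0 q < n1 q -> n1 q < n2 q -> n2 q < n3 q -> n0 q <= f q <= n3 q) ->
  limF (near4 x) f x.
Proof.
  intros h; apply limF_iff; [apply near4_filter |].
  intros eps heps; exists eps; split; [trivial |].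
  intros x0 x1 x2 x3 ? ? ? ? ?; specialize (h (Nodes4 x0 x1 x2 x3)).
  simpl in h; apply Rabs_def1; lra.
Qed.

(** The form in which the mean value property of divided differences yields their
    limits; [k] is the factorial of the order. *)
Lemma near4_mean (x : R) (f : nodes4 -> R) (g : R -> R) (k : R) :
  continuous g x ->
  (forall q, n0 q < n1 q -> n1 q < n2 q -> n2 q < n3 q ->
     exists z, n0 q <= z <= n3 q /\ f q = g z / k) ->
  limF (near4 x) f (g x / k).
Proof.
  intros hg h.
  assert (hgk : continuous (fun t => g t / k) x).
  { apply (continuous_mult g (fun _ => / k)); trivial; apply continuous_const. }
  apply limF_iff; [apply near4_filter |]; intros eps heps.
  destruct (proj1 (filterlim_locally _ _) hgk (mkposreal eps heps))
    as [d hd].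
  exists d; split; [apply cond_pos |]; intros x0 x1 x2 x3 ? ? ? ? ?.
  destruct (h (Nodes4 x0 x1 x2 x3)) as [z [hz ->]]; trivial; simpl in hz.
  apply hd; change (Rabs (z - x) < d); apply Rabs_def1; lra.
Qed.

Definition vdd1 (C : R -> R3) (x y : R) : R3 :=
  (dd1 (fun t => coord 0 (C t)) x y, dd1 (fun t => coord 1 (C t)) x y,
   dd1 (fun t => coord 2 (C t)) x y).
Definition vdd2 (C : R -> R3) (x y z : R) : R3 :=
  (dd2 (fun t => coord 0 (C t)) x y z, dd2 (fun t => coord 1 (C t)) x y z,
   dd2 (fun t => coord 2 (C t)) x y z).
Definition vdd3 (C : R -> R3) (x y z w : R) : R3 :=
  (dd3 (fun t => coord 0 (C t)) x y z w, dd3 (fun t => coord 1 (C t)) x y z w,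
   dd3 (fun t => coord 2 (C t)) x y z w).

Section Curve.

Context (C C1 C2 C3 : R -> R3) (hC : is_C3 C C1 C2 C3).

Lemma C_continuous (j : nat) (x : R) :
  continuous (fun t => coord j (C t)) x /\
  continuous (fun t => coord j (C1 t)) x /\
  continuous (fun t => coord j (C2 t)) x /\
  continuous (fun t => coord j (C3 t)) x.
Proof.
  destruct (hC j x) as [h [h1 [h2 h3]]]; repeat split; trivial;
    apply (ex_derive_continuous (V := R_NormedModule)); eexists; eassumption.
Qed.

Lemma near4_curve_value (D : R -> R3) (x : R) (f : nodes4 -> R) :
  (forall j, continuous (fun t => coord j (D t)) x) ->
  (forall q, n0 q < n1 q -> n1 q < n2 q -> n2 q < n3 q -> n0 q <= f q <= n3 q) ->
  vlimF (near4 x) (fun q => D (f q)) (D x).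
Proof.
  intros h hf j.
  apply (limF_comp _ f (fun t => coord j (D t))); [| apply h].
  now apply near4_point.
Qed.

Lemma near4_vdd1 (x : R) (f g : nodes4 -> R) :
  (forall q, n0 q < n1 q -> n1 q < n2 q -> n2 q < n3 q ->
     n0 q <= f q /\ f q < g q /\ g q <= n3 q) ->
  vlimF (near4 x) (fun q => vdd1 C (f q) (g q)) (C1 x).
Proof.
  intros h j.
  apply (limF_ext _ (fun q => dd1 (fun t => coord j (C t)) (f q) (g q)) _
    (coord j (C1 x) / 1)); [| field |].
  { now intros q; destruct j as [| [| j]]. }
  apply (near4_mean x _ (fun t => coord j (C1 t)) 1); [apply C_continuous |].
  intros q h0 h1 h2; destruct (h q h0 h1 h2) as [? [? ?]].
  destruct (dd1_mean (fun t => coord j (C t)) (fun t => coord j (C1 t))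
    (f q) (g q)) as [z [hz e]]; trivial; [intros; apply hC |].
  exists z; rewrite e; split; [lra | field].
Qed.

Lemma near4_vdd2 (x : R) (f g k : nodes4 -> R) :
  (forall q, n0 q < n1 q -> n1 q < n2 q -> n2 q < n3 q ->
     n0 q <= f q /\ f q < g q /\ g q < k q /\ k q <= n3 q) ->
  vlimF (near4 x) (fun q => vdd2 C (f q) (g q) (k q)) (scal (/ 2) (C2 x)).
Proof.
  intros h j.
  apply (limF_ext _ (fun q => dd2 (fun t => coord j (C t)) (f q) (g q) (k q)) _
    (coord j (C2 x) / 2)).
  { now intros q; destruct j as [| [| j]]. }
  { destruct (C2 x) as [[? ?] ?], j as [| [| j]]; vec; field. }
  apply (near4_mean x _ (fun t => coord j (C2 t)) 2); [apply C_continuous |].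
  intros q h0 h1 h2; destruct (h q h0 h1 h2) as [? [? [? ?]]].
  destruct (dd2_mean (fun t => coord j (C t)) (fun t => coord j (C1 t))
    (fun t => coord j (C2 t)) (f q) (g q) (k q)) as [z [hz e]]; trivial;
    try (intros; apply hC).
  exists z; rewrite e; split; [lra | field].
Qed.

Lemma near4_vdd3 (x : R) :
  vlimF (near4 x) (fun q => vdd3 C (n0 q) (n1 q) (n2 q) (n3 q))
    (scal (/ 6) (C3 x)).
Proof.
  intros j.
  apply (limF_ext _ (fun q => dd3 (fun t => coord j (C t))
    (n0 q) (n1 q) (n2 q) (n3 q)) _ (coord j (C3 x) / 6)).
  { now intros q; destruct j as [| [| j]]. }
  { destruct (C3 x) as [[? ?] ?], j as [| [| j]]; vec; field. }
  apply (near4_mean x _ (fun t => coord j (C3 t)) 6); [apply C_continuous |].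
  intros q h0 h1 h2.
  destruct (dd3_mean (fun t => coord j (C t)) (fun t => coord j (C1 t))
    (fun t => coord j (C2 t)) (fun t => coord j (C3 t))
    (n0 q) (n1 q) (n2 q) (n3 q)) as [z [hz e]]; trivial;
    try (intros; apply hC).
  exists z; rewrite e; split; [lra | field].
Qed.

End Curve.

(** * Discrete binormals of consecutive nodes *)

Definition seg3 (C : R -> R3) (x y z : R) : R3 :=
  cross (minus (C y) (C x)) (minus (C z) (C y)).

(** The two segments are [C[x,y]] and [C[y,z]] up to length, and these two vectors
    differ by [(z - x) C[x,y,z]], so that either of them may be kept as the first
    factor. *)
Lemma seg3_left (C : R -> R3) (x y z : R) : x < y -> y < z ->
  seg3 C x y z = scal ((y - x) * (z - y) * (z - x))
                   (cross (vdd1 C x y) (vdd2 C x y z)).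
Proof.
  intros hxy hyz; unfold seg3, vdd1, vdd2, dd2, dd1.
  destruct (C x) as [[a1 a2] a3], (C y) as [[b1 b2] b3],
    (C z) as [[c1 c2] c3].
  apply R3_ext; intros [| [| j]]; vec; field; repeat split; lra.
Qed.

Lemma seg3_right (C : R -> R3) (x y z : R) : x < y -> y < z ->
  seg3 C x y z = scal ((y - x) * (z - y) * (z - x))
                   (cross (vdd1 C y z) (vdd2 C x y z)).
Proof.
  intros hxy hyz; unfold seg3, vdd1, vdd2, dd2, dd1.
  destruct (C x) as [[a1 a2] a3], (C y) as [[b1 b2] b3],
    (C z) as [[c1 c2] c3].
  apply R3_ext; intros [| [| j]]; vec; field; repeat split; lra.
Qed.

Lemma vdd2_vdd3 (C : R -> R3) (x y z w : R) : x < w ->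
  vdd2 C y z w = plus (vdd2 C x y z) (scal (w - x) (vdd3 C x y z w)).
Proof.
  intros h; apply R3_ext; intros [| [| j]]; unfold vdd2, vdd3, dd3; vec;
    field; lra.
Qed.

(** The case of [(p × a) × (p × b) = det (p, a, b) p] in which [b - a] is a
    multiple of [r]. *)
Lemma cross_common_factor (p q r : R3) (h : R) :
  cross (cross p q) (cross p (plus q (scal h r)))
  = scal (h * dot (cross p q) r) p.
Proof. apply R3_ext; intros [| [| j]]; vec; ring. Qed.

(** [(sin d) / h] for the distance [d] of the two binormals of four consecutive
    nodes whose extremes have distance [h]. *)
Definition torsion_quotient (C : R -> R3) (x y z w : R) : R :=
  let W := cross (vdd1 C y z) (vdd2 C x y z) in
  let W' := cross (vdd1 C y z) (vdd2 C y z w) in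
  norm (vdd1 C y z) * Rabs (dot W (vdd3 C x y z w)) / (norm W * norm W').

Lemma seg3_pos_multiple (a : R) (v : R3) :
  0 < a -> scal a v <> zero -> v <> zero.
Proof.
  intros ha h -> ; apply h; apply R3_ext; intros [| [| j]]; vec; ring.
Qed.

(** The two planes share the chord from [C y] to [C z], so the cross product of
    their normals is a multiple of that chord, and the factor contains only the
    difference of the second divided differences, that is
    [(w - x)] times the third one. *)
Lemma dRP2_binormals (C : R -> R3) (x y z w : R) :
  x < y -> y < z -> z < w ->
  seg3 C x y z <> zero -> seg3 C y z w <> zero ->
  dRP2 (cls (normalize (seg3 C x y z))) (cls (normalize (seg3 C y z w)))
  = asin ((w - x) * torsion_quotient C x y z w).
Proof.
  intros hxy hyz hzw; rewrite seg3_right, seg3_left by trivial.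
  assert (p1 : 0 < (y - x) * (z - y) * (z - x))
    by (repeat apply Rmult_lt_0_compat; lra).
  assert (p2 : 0 < (z - y) * (w - z) * (w - y))
    by (repeat apply Rmult_lt_0_compat; lra).
  intros n1 n2; apply seg3_pos_multiple in n1, n2; trivial.
  rewrite !normalize_scal by trivial.
  rewrite dRP2_asin, !normalize_val by trivial.
  f_equal; unfold torsion_quotient; cbv zeta.
  set (p := vdd1 C y z) in *; set (q := vdd2 C x y z) in *.
  set (q' := vdd2 C y z w) in *; set (r := vdd3 C x y z w) in *.
  assert (e : q' = plus q (scal (w - x) r)) by (apply vdd2_vdd3; lra).
  set (W := cross p q) in *; set (W' := cross p q') in *.
  assert (hW := norm_pos W n1); assert (hW' := norm_pos W' n2).
  replace (cross (scal (/ norm W) W) (scal (/ norm W') W'))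
    with (scal (/ norm W * / norm W') (cross W W')).
  - assert (eW : cross W W' = scal ((w - x) * dot W r) p).
    { unfold W', W; rewrite e; apply cross_common_factor. }
    rewrite eW, !norm_scal_abs, !Rabs_mult.
    rewrite (Rabs_pos_eq (/ norm W)), (Rabs_pos_eq (/ norm W')),
      (Rabs_pos_eq (w - x))
      by (try (left; apply Rinv_0_lt_compat); lra).
    field; lra.
  - clear; generalize (/ norm W), (/ norm W'); intros a b.
    destruct W as [[? ?] ?], W' as [[? ?] ?].
    apply R3_ext; intros [| [| j]]; vec; ring.
Qed.

(** Completed by its limit at [0], it replaces the expansion of the arc sine. *)
Definition asin_quotient (v : R) : R := if Req_EM_T v 0 then 1 else asin v / v.

Lemma asin_quotient_eq (v : R) : asin v = v * asin_quotient v.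
Proof.
  unfold asin_quotient; destruct (Req_EM_T v 0) as [-> | n].
  - rewrite asin_0; ring.
  - field; trivial.
Qed.

Lemma asin_quotient_continuous : continuous asin_quotient 0.
Proof.
  apply filterlim_locally; intros eps.
  assert (h : -1 < 0 < 1) by lra.
  assert (hd := derive_pt_asin 0 h).
  assert (hl : derivable_pt_lim asin 0 1).
  { replace 1 with (1 / sqrt (1 - Rsqr 0)).
    - rewrite <- hd; apply derive_pt_eq_1 with (derivable_pt_asin 0 h).
      reflexivity.
    - unfold Rsqr; replace (1 - 0 * 0) with 1 by ring.
      rewrite sqrt_1; field. }
  destruct (hl eps (cond_pos eps)) as [d hdl].
  exists d; intros v hv.
  change (Rabs (v - 0) < d) in hv; rewrite Rminus_0_r in hv.
  change (Rabs (asin_quotient v - asin_quotient 0) < eps).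
  unfold asin_quotient; destruct (Req_EM_T 0 0) as [_ | n]; [| lra].
  destruct (Req_EM_T v 0) as [-> | n].
  - rewrite Rminus_diag, Rabs_R0; apply cond_pos.
  - specialize (hdl v n hv); now rewrite Rplus_0_l, asin_0, Rminus_0_r in hdl.
Qed.

Section Local.

Context (C C1 C2 C3 : R -> R3) (hC : is_C3 C C1 C2 C3).

Definition osc_normal (x : R) : R3 := cross (C1 x) (C2 x).

(** The absolute torsion multiplied by the speed, for any parameterization. *)
Definition abs_torsion (x : R) : R :=
  norm (C1 x) * Rabs (dot (osc_normal x) (C3 x))
  / (norm (osc_normal x) * norm (osc_normal x)).

Lemma near4_osculating (x : R) (f g k l m : nodes4 -> R) :
  (forall q, n0 q < n1 q -> n1 q < n2 q -> n2 q < n3 q ->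
     n0 q <= f q /\ f q < g q /\ g q <= n3 q) ->
  (forall q, n0 q < n1 q -> n1 q < n2 q -> n2 q < n3 q ->
     n0 q <= k q /\ k q < l q /\ l q < m q /\ m q <= n3 q) ->
  vlimF (near4 x) (fun q => cross (vdd1 C (f q) (g q)) (vdd2 C (k q) (l q) (m q)))
    (scal (/ 2) (osc_normal x)).
Proof.
  intros h1 h2.
  replace (scal (/ 2) (osc_normal x)) with (cross (C1 x) (scal (/ 2) (C2 x))).
  - apply vlimF_cross; [apply near4_filter | |].
    + now apply near4_vdd1 with C2 C3.
    + now apply near4_vdd2 with C1 C3.
  - unfold osc_normal; destruct (C1 x) as [[? ?] ?], (C2 x) as [[? ?] ?].
    apply R3_ext; intros [| [| j]]; vec; ring.
Qed.

Lemma half_osc_nonzero (x : R) :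
  osc_normal x <> zero -> scal (/ 2) (osc_normal x) <> zero.
Proof.
  intros h; apply norm_neq0; rewrite norm_scal_pos by lra.
  assert (hn := norm_pos _ h); lra.
Qed.

(** The factors [1/2], [1/2] and [1/6] of the divided differences combine to
    [1/12] in the numerator and [1/4] in the denominator. *)
Lemma near4_torsion_quotient (x : R) :
  osc_normal x <> zero ->
  limF (near4 x) (fun q => torsion_quotient C (n0 q) (n1 q) (n2 q) (n3 q))
    (abs_torsion x / 3).
Proof.
  intros hx; assert (hn := norm_pos _ hx).
  assert (FF : Filter (near4 x)) by apply near4_filter.
  assert (hp : vlimF (near4 x) (fun q => vdd1 C (n1 q) (n2 q)) (C1 x)).
  { apply near4_vdd1 with C2 C3; trivial; intros; lra. }
  assert (hW : vlimF (near4 x)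
    (fun q => cross (vdd1 C (n1 q) (n2 q)) (vdd2 C (n0 q) (n1 q) (n2 q)))
    (scal (/ 2) (osc_normal x))) by (apply near4_osculating; intros; lra).
  assert (hW' : vlimF (near4 x)
    (fun q => cross (vdd1 C (n1 q) (n2 q)) (vdd2 C (n1 q) (n2 q) (n3 q)))
    (scal (/ 2) (osc_normal x))) by (apply near4_osculating; intros; lra).
  assert (hr := near4_vdd3 C C1 C2 C3 hC x).
  assert (e : norm (scal (/ 2) (osc_normal x)) = / 2 * norm (osc_normal x))
    by (apply norm_scal_pos; lra).
  assert (e' : dot (scal (/ 2) (osc_normal x)) (scal (/ 6) (C3 x))
               = / 12 * dot (osc_normal x) (C3 x)).
  { destruct (osc_normal x) as [[? ?] ?], (C3 x) as [[? ?] ?]; vec; field. }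
  assert (H := limF_div _ _ _ _ _
    (limF_mult _ _ _ _ _ (limF_norm _ _ _ hp)
       (limF_comp _ _ Rabs _ (limF_dot _ _ _ _ _ hW hr) (continuous_Rabs _)))
    (limF_mult _ _ _ _ _ (limF_norm _ _ _ hW) (limF_norm _ _ _ hW'))).
  revert H; rewrite e, e'; intros H.
  refine (limF_ext _ _ _ _ _ (fun q => eq_refl) _ (H _)).
  - unfold abs_torsion; rewrite Rabs_mult, (Rabs_pos_eq (/ 12)) by lra.
    field; lra.
  - apply Rgt_not_eq; apply Rmult_lt_0_compat; lra.
Qed.

Lemma near4_binormal (x : R) (f g k : nodes4 -> R) :
  (forall q, n0 q < n1 q -> n1 q < n2 q -> n2 q < n3 q ->
     n0 q <= f q /\ f q < g q /\ g q < k q /\ k q <= n3 q) ->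
  osc_normal x <> zero ->
  near4 x (fun q => n0 q < n1 q -> n1 q < n2 q -> n2 q < n3 q ->
             seg3 C (f q) (g q) (k q) <> zero) /\
  (forall eps, 0 < eps ->
     near4 x (fun q => n0 q < n1 q -> n1 q < n2 q -> n2 q < n3 q ->
       dist3 (S2val (normalize (seg3 C (f q) (g q) (k q))))
             (S2val (normalize (osc_normal (g q)))) <= eps)).
Proof.
  intros h hx; assert (FF : Filter (near4 x)) by apply near4_filter.
  assert (hW : vlimF (near4 x)
    (fun q => cross (vdd1 C (f q) (g q)) (vdd2 C (f q) (g q) (k q)))
    (scal (/ 2) (osc_normal x))).
  { apply near4_osculating; intros q a b c; specialize (h q a b c); lra. }
  assert (hO : vlimF (near4 x) (fun q => osc_normal (g q)) (osc_normal x)).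
  { apply vlimF_cross; trivial;
      (apply near4_curve_value;
        [intros j; apply (C_continuous C C1 C2 C3 hC j x) |
         intros q a b c; specialize (h q a b c); lra]). }
  destruct (vlimF_normalize _ _ _ hW (half_osc_nonzero x hx)) as [nW lW].
  destruct (vlimF_normalize _ _ _ hO hx) as [nO lO].
  assert (pos : forall q, n0 q < n1 q -> n1 q < n2 q -> n2 q < n3 q ->
    0 < (g q - f q) * (k q - g q) * (k q - f q)).
  { intros q a b c; specialize (h q a b c).
    repeat apply Rmult_lt_0_compat; lra. }
  split.
  - revert nW; apply filter_imp; intros q n a b c.
    assert (p := pos q a b c); specialize (h q a b c).
    rewrite seg3_left by lra.
    apply norm_neq0; rewrite norm_scal_pos by lra.
    apply Rmult_lt_0_compat; [lra | now apply norm_pos].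
  - intros eps heps; rewrite normalize_scal in lW by (trivial; lra).
    assert (H : forall j, near4 x (fun q =>
      Rabs (coord j (S2val (normalize
              (cross (vdd1 C (f q) (g q)) (vdd2 C (f q) (g q) (k q)))))
            - coord j (S2val (normalize (osc_normal (g q))))) < eps / 3)).
    { intros j; assert (hj := limF_minus _ _ _ _ _ (lW j) (lO j)).
      rewrite Rminus_diag in hj.
      apply (proj1 (limF_iff _ _ _)) with (eps := eps / 3) in hj; [| lra].
      revert hj; apply filter_imp; intros q; now rewrite Rminus_0_r. }
    assert (H3 := filter_and _ _ nW (filter_and _ _ (H 0%nat)
                    (filter_and _ _ (H 1%nat) (H 2%nat)))).
    revert H3; apply filter_imp; intros q [n [b0 [b1 b2]]] a b c.
    assert (p := pos q a b c); specialize (h q a b c).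
    rewrite seg3_left, normalize_scal by (trivial; lra).
    replace eps with (3 * (eps / 3)) by field.
    apply dist3_coords; intros [| [| j]]; left; trivial.
Qed.

Context (theta F : R -> R) (htheta : forall x, continuous theta x)
  (hF : forall x, is_derive F x (theta x)).

(** What holds for all nodes close to one point; it mentions the nodes only, so
    that it can be made uniform by compactness. *)
Record good_nodes (eps a b : R) : Prop := GoodNodes {
  good_turn : forall x y z, a < x -> x < y -> y < z -> z < b ->
    seg3 C x y z <> zero /\
    dist3 (S2val (normalize (seg3 C x y z)))
          (S2val (normalize (osc_normal y))) <= eps;
  good_arc : forall x y z w, a < x -> x < y -> y < z -> z < w -> w < b ->
    Rabs (dRP2 (cls (normalize (seg3 C x y z)))
               (cls (normalize (seg3 C y z w))) - (F w - F x) / 3)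
    <= eps * (w - x);
  good_value : forall x y, a < x -> x <= y -> y < b -> Rabs (F y - F x) <= eps }.

Lemma good_nodes_turn_local (x eps : R) :
  osc_normal x <> zero -> 0 < eps ->
  exists d, 0 < d /\ forall y0 y1 y2,
    x - d < y0 -> y0 < y1 -> y1 < y2 -> y2 < x + d ->
    seg3 C y0 y1 y2 <> zero /\
    dist3 (S2val (normalize (seg3 C y0 y1 y2))) (S2val (normalize (osc_normal y1)))
    <= eps.
Proof.
  intros hx heps.
  destruct (near4_binormal x n0 n1 n2) as [[d1 [p1 h1]] h]; trivial;
    [intros; lra |].
  destruct (h eps heps) as [d2 [p2 h2]].
  exists (Rmin d1 d2); split; [now apply Rmin_glb_lt |].
  assert (l1 := Rmin_l d1 d2); assert (l2 := Rmin_r d1 d2).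
  intros y0 y1 y2 a b c e.
  (* any node between [y2] and the end of the neighbourhood completes the
     triple to a quadruple *)
  set (y3 := (y2 + (x + Rmin d1 d2)) / 2).
  assert (hy3 : y2 < y3 < x + Rmin d1 d2) by (unfold y3; lra).
  specialize (h1 y0 y1 y2 y3); specialize (h2 y0 y1 y2 y3); simpl in h1, h2.
  split; [apply h1 | apply h2]; lra.
Qed.

(** Both the distance and the increment of [F], divided by the length
    [y3 - y0], have a limit at [x], and the limits are [theta x / 3] and
    [theta x]. *)
Lemma good_nodes_arc_local (x eps : R) :
  osc_normal x <> zero -> theta x = abs_torsion x -> 0 < eps ->
  exists d, 0 < d /\ forall y0 y1 y2 y3,
    x - d < y0 -> y0 < y1 -> y1 < y2 -> y2 < y3 -> y3 < x + d ->
    Rabs (dRP2 (cls (normalize (seg3 C y0 y1 y2)))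
               (cls (normalize (seg3 C y1 y2 y3))) - (F y3 - F y0) / 3)
    <= eps * (y3 - y0).
Proof.
  intros hx ht heps.
  assert (FF : Filter (near4 x)) by apply near4_filter.
  assert (hQ := near4_torsion_quotient x hx); rewrite <- ht in hQ.
  assert (h03 : limF (near4 x) (fun q => n3 q - n0 q) 0).
  { rewrite <- (Rminus_diag x); apply limF_minus; trivial;
      apply near4_point; intros; lra. }
  assert (hg := limF_comp _ _ asin_quotient _ (limF_mult _ _ _ _ _ h03 hQ)).
  rewrite Rmult_0_l in hg; specialize (hg asin_quotient_continuous).
  replace (asin_quotient 0) with 1 in hg
    by (unfold asin_quotient; destruct (Req_EM_T 0 0); lra).
  assert (hD : limF (near4 x) (fun q => dd1 F (n0 q) (n3 q)) (theta x)).
  { apply (limF_ext _ _ _ (theta x / 1) _ (fun q => eq_refl)); [field |].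
    apply near4_mean; [apply htheta |]; intros q a b c.
    destruct (dd1_mean F theta (n0 q) (n3 q) hF ltac:(lra)) as [z [hz e]].
    exists z; rewrite e; split; [lra | field]. }
  assert (H := limF_minus _ _ _ _ _ (limF_mult _ _ _ _ _ hQ hg)
                 (limF_mult _ _ _ _ _ hD (limF_const _ (/ 3)))).
  replace (theta x / 3 * 1 - theta x * / 3) with 0 in H by field.
  apply (proj1 (limF_iff _ _ _)) with (eps := eps) in H; trivial.
  destruct H as [d1 [p1 H]].
  destruct (good_nodes_turn_local x eps hx heps) as [d2 [p2 h2]].
  exists (Rmin d1 d2); split; [now apply Rmin_glb_lt |].
  assert (l1 := Rmin_l d1 d2); assert (l2 := Rmin_r d1 d2).
  intros y0 y1 y2 y3 a b c d e.
  destruct (h2 y0 y1 y2) as [n1' _]; try lra.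
  destruct (h2 y1 y2 y3) as [n2' _]; try lra.
  rewrite dRP2_binormals, asin_quotient_eq by trivial.
  specialize (H y0 y1 y2 y3); simpl in H; rewrite Rminus_0_r in H.
  assert (H' := H ltac:(lra) b c d ltac:(lra)); clear H.
  set (Q := torsion_quotient C y0 y1 y2 y3) in *.
  set (G := asin_quotient _) in *.
  replace ((y3 - y0) * Q * G - (F y3 - F y0) / 3)
    with ((Q * G - dd1 F y0 y3 * / 3) * (y3 - y0))
    by (unfold dd1; field; lra).
  rewrite Rabs_mult, (Rabs_pos_eq (y3 - y0)) by lra.
  apply Rmult_le_compat_r; lra.
Qed.

Lemma good_nodes_value_local (x eps : R) : 0 < eps ->
  exists d, 0 < d /\ forall y z,
    x - d < y -> y <= z -> z < x + d -> Rabs (F z - F y) <= eps.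
Proof.
  intros heps.
  assert (hc : continuous F x)
    by (apply (ex_derive_continuous (V := R_NormedModule)); now exists (theta x)).
  assert (he : 0 < eps / 2) by lra.
  destruct (proj1 (filterlim_locally _ _) hc (mkposreal _ he)) as [d hd].
  exists d; split; [apply cond_pos |]; intros y z hy hyz hz.
  assert (by' : Rabs (F y - F x) < eps / 2).
  { apply hd; change (Rabs (y - x) < d); apply Rabs_def1; lra. }
  assert (bz : Rabs (F z - F x) < eps / 2).
  { apply hd; change (Rabs (z - x) < d); apply Rabs_def1; lra. }
  apply Rabs_def2 in by', bz; apply Rabs_le; lra.
Qed.

Lemma good_nodes_local (x eps : R) :
  osc_normal x <> zero -> theta x = abs_torsion x -> 0 < eps ->
  exists d, 0 < d /\ good_nodes eps (x - d) (x + d).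
Proof.
  intros hx ht heps.
  destruct (good_nodes_turn_local x eps hx heps) as [d1 [p1 h1]].
  destruct (good_nodes_arc_local x eps hx ht heps) as [d2 [p2 h2]].
  destruct (good_nodes_value_local x eps heps) as [d3 [p3 h3]].
  exists (Rmin d1 (Rmin d2 d3)); split; [repeat apply Rmin_glb_lt; lra |].
  assert (l1 := Rmin_l d1 (Rmin d2 d3)); assert (l2 := Rmin_r d1 (Rmin d2 d3)).
  assert (l3 := Rmin_l d2 d3); assert (l4 := Rmin_r d2 d3).
  split; intros; [apply h1 | apply h2 | apply h3]; lra.
Qed.

End Local.

Lemma good_nodes_sub (C C1 C2 : R -> R3) (F : R -> R) (eps a b a' b' : R) :
  a <= a' -> b' <= b -> good_nodes C C1 C2 F eps a b ->
  good_nodes C C1 C2 F eps a' b'.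
Proof.
  intros ha hb [h1 h2 h3]; split; intros; [apply h1 | apply h2 | apply h3]; lra.
Qed.

(** A Lebesgue number of the covering of the segment by the neighbourhoods that
    the local property provides. *)
Lemma uniform_on_segment (M : R) (P : R -> R -> Prop) :
  (forall a b a' b', a <= a' -> b' <= b -> P a b -> P a' b') ->
  (forall x, 0 <= x <= M -> exists d, 0 < d /\ P (x - d) (x + d)) ->
  exists d, 0 < d /\ forall x, 0 <= x <= M -> P (x - d) (x + d).
Proof.
  intros mono h.
  assert (hd : forall x, exists d : posreal,
    0 <= x <= M -> P (x - 2 * d) (x + 2 * d)).
  { intros x; destruct (Rle_dec 0 x) as [h0 |]; [| exists (mkposreal 1 Rlt_0_1);
      intros; lra].
    destruct (Rle_dec x M) as [h1 |]; [| exists (mkposreal 1 Rlt_0_1);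
      intros; lra].
    destruct (h x (conj h0 h1)) as [d [hd hp]].
    assert (hd2 : 0 < d / 2) by lra.
    exists (mkposreal _ hd2); intros _; simpl.
    now replace (2 * (d / 2)) with d by field. }
  set (delta := fun x => proj1_sig (constructive_indefinite_description _ (hd x))).
  destruct (compactness_value_1d 0 M delta) as [d hdd].
  exists d; split; [apply cond_pos |]; intros x hx.
  specialize (hdd x hx); apply Classical_Prop.NNPP in hdd.
  destruct hdd as [t [ht [hxt hle]]].
  assert (hp : P (t - 2 * delta t) (t + 2 * delta t)).
  { unfold delta; now destruct (constructive_indefinite_description _ (hd t)) as
      [e he]; apply he. }
  apply Rabs_def2 in hxt; revert hp; apply mono; lra.
Qed.

(** * Summation along a polygonal *)

Lemma sum_over_S (a m : nat) (f : nat -> R) :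
  sum_over (seq a (S m)) f = sum_over (seq a m) f + f (a + m)%nat.
Proof.
  unfold sum_over; rewrite seq_S, map_app, fold_right_app; simpl.
  rewrite Rplus_0_r; generalize (f (a + m)%nat) as r; intros r.
  induction (map f (seq a m)) as [| y l IH]; simpl; [| rewrite IH]; ring.
Qed.

(** Indexed, as the discrete binormals of a polygonal, by the middle node. *)
Definition node_binormal (C : R -> R3) (X : nat -> R) (i : nat) : S2 :=
  normalize (seg3 C (X (i - 1)%nat) (X i) (X (S i))).

Definition node_torsion (C : R -> R3) (X : nat -> R) (m : nat) : R :=
  sum_over (seq 2 m) (fun i =>
    dRP2 (cls (node_binormal C X (i - 1))) (cls (node_binormal C X i))).

Definition fine_nodes (d : R) (N : nat) (X : nat -> R) : Prop :=
  forall i, (i < N)%nat -> X i < X (S i) < X i + d.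

Lemma fine_nodes_le (d : R) (N : nat) (X : nat -> R) :
  fine_nodes d N X -> forall i j, (i <= j)%nat -> (j <= N)%nat -> X i <= X j.
Proof.
  intros h i j hij; induction hij as [| j hij IH]; intros hj; [lra |].
  specialize (h j ltac:(lia)); specialize (IH ltac:(lia)); lra.
Qed.

(** Each distance is nearly a third of the torsion of three intervals, and
    the sum telescopes since every interval away from the ends is counted three
    times. *)
Lemma node_torsion_telescope (C C1 C2 : R -> R3) (F : R -> R)
    (e d M : R) (N : nat) (X : nat -> R) :
  0 < e -> 0 < d ->
  (forall x, 0 <= x <= M -> good_nodes C C1 C2 F e (x - d) (x + d)) ->
  fine_nodes (d / 3) N X -> 0 <= X 0%nat -> X N <= M ->
  forall m, (S (S m) <= N)%nat ->
    Rabs (node_torsion C X m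
          - (F (X (S (S m))) + F (X (S m)) + F (X m)
             - F (X 2%nat) - F (X 1%nat) - F (X 0%nat)) / 3)
    <= e * (X (S (S m)) + X (S m) + X m - X 2%nat - X 1%nat - X 0%nat).
Proof.
  intros he hd good fine h0 hN; induction m as [| m IH]; intros hm.
  - unfold node_torsion, sum_over; simpl.
    match goal with |- Rabs ?t <= ?u => replace t with 0 by field;
      replace u with 0 by ring end.
    rewrite Rabs_R0; lra.
  - specialize (IH ltac:(lia)); unfold node_torsion in *.
    rewrite sum_over_S.
    assert (f0 := fine m ltac:(lia)); assert (f1 := fine (S m) ltac:(lia)).
    assert (f2 := fine (S (S m)) ltac:(lia)).
    assert (b0 := fine_nodes_le _ _ _ fine 0 m ltac:(lia) ltac:(lia)).
    assert (bN := fine_nodes_le _ _ _ fine m N ltac:(lia) ltac:(lia)).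
    destruct (good (X m) ltac:(lra)) as [_ arc _].
    specialize (arc (X m) (X (S m)) (X (S (S m))) (X (S (S (S m))))
      ltac:(lra) ltac:(lra) ltac:(lra) ltac:(lra) ltac:(lra)).
    unfold node_binormal at 3 4; simpl; rewrite Nat.sub_0_r.
    set (D := dRP2 _ (cls (normalize (seg3 C (X (S m)) _ _)))) in *.
    set (S0 := sum_over _ _) in *.
    match goal with |- Rabs ?t <= ?u =>
      match type of IH with Rabs ?a <= ?a' =>
        match type of arc with Rabs ?b <= ?b' =>
          replace t with (a + b) by field; replace u with (a' + b') by ring
        end end end.
    eapply Rle_trans; [apply Rabs_triang | now apply Rplus_le_compat].
Qed.

Section Estimate.

Context (C C1 C2 C3 : R -> R3) (hC : is_C3 C C1 C2 C3)
  (theta F : R -> R) (htheta : forall x, continuous theta x)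
  (hF : forall x, is_derive F x (theta x))
  (M : R) (hM : 0 <= M)
  (hosc : forall x, 0 <= x <= M -> osc_normal C1 C2 x <> zero)
  (hat : forall x, 0 <= x <= M -> theta x = abs_torsion C1 C2 C3 x).

(** The telescoped sum is a mean of the values of [F] at three consecutive nodes,
    minus the same mean at the beginning. *)
Lemma node_estimate (eps : R) : 0 < eps -> exists d, 0 < d /\
  forall N X, fine_nodes d N X -> 0 <= X 0%nat -> X N <= M ->
    (forall i, (S (S i) <= N)%nat ->
       seg3 C (X i) (X (S i)) (X (S (S i))) <> zero /\
       dist3 (S2val (node_binormal C X (S i)))
             (S2val (normalize (osc_normal C1 C2 (X (S i))))) <= eps) /\
    (forall m, (S (S m) <= N)%nat ->
       Rabs (node_torsion C X m - (F (X (S m)) - F (X 0%nat))) <= eps).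
Proof.
  (* [3 * M] bounds the sum of the lengths of the triples of intervals, and [2]
     the errors at both ends *)
  intros heps; set (e := eps / (3 * M + 2)).
  assert (he : 0 < e) by (apply Rdiv_lt_0_compat; lra).
  assert (ee : e * (3 * M + 2) = eps) by (unfold e; field; lra).
  destruct (uniform_on_segment M (good_nodes C C1 C2 F e)) as [d [hd good]].
  { intros a b a' b'; apply good_nodes_sub. }
  { intros x hx; apply good_nodes_local with C3 theta; auto. }
  exists (d / 3); split; [lra |]; intros N X fine h0 hN.
  assert (range : forall i, (i <= N)%nat -> 0 <= X i <= M).
  { intros i hi; assert (l1 := fine_nodes_le _ _ _ fine 0 i ltac:(lia) hi).
    assert (l2 := fine_nodes_le _ _ _ fine i N hi (le_n N)); lra. }
  split.
  - intros i hi; assert (f0 := fine i ltac:(lia)).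
    assert (f1 := fine (S i) ltac:(lia)).
    destruct (good (X i) (range i ltac:(lia))) as [turn _ _].
    destruct (turn (X i) (X (S i)) (X (S (S i)))) as [t1 t2]; try lra.
    split; trivial; unfold node_binormal; simpl; rewrite Nat.sub_0_r.
    eapply Rle_trans; [apply t2 |]; nra.
  - intros m hm.
    assert (T := node_torsion_telescope C C1 C2 F e d M N X he hd good fine
                   h0 hN m hm).
    assert (v : forall i j, (i <= j)%nat -> (j <= N)%nat -> X j < X i + d ->
                  Rabs (F (X j) - F (X i)) <= e).
    { intros i j hij hj hlt.
      destruct (good (X i) (range i ltac:(lia))) as [_ _ val].
      assert (l := fine_nodes_le _ _ _ fine i j hij hj).
      apply val; lra. }
    assert (f0 := fine 0%nat ltac:(lia)); assert (f1 := fine 1%nat ltac:(lia)).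
    assert (g0 := fine m ltac:(lia)); assert (g1 := fine (S m) ltac:(lia)).
    assert (v1 := v 0%nat 1%nat ltac:(lia) ltac:(lia) ltac:(lra)).
    assert (v2 := v 0%nat 2%nat ltac:(lia) ltac:(lia) ltac:(lra)).
    assert (w1 := v m (S m) ltac:(lia) ltac:(lia) ltac:(lra)).
    assert (w2 := v (S m) (S (S m)) ltac:(lia) ltac:(lia) ltac:(lra)).
    assert (r0 := range 0%nat ltac:(lia)); assert (r1 := range 1%nat ltac:(lia)).
    assert (r2 := range 2%nat ltac:(lia)); assert (s0 := range m ltac:(lia)).
    assert (s1 := range (S m) ltac:(lia)).
    assert (s2 := range (S (S m)) ltac:(lia)).
    assert (he3 : e * (X (S (S m)) + X (S m) + X m - X 2%nat - X 1%nat - X 0%nat)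
                  <= e * (3 * M)) by (apply Rmult_le_compat_l; lra).
    apply Rabs_le_between in T, v1, v2, w1, w2; apply Rabs_le; lra.
Qed.

End Estimate.

(** * Arc-length parameterization *)

Lemma arc_length_lipschitz {X : Type} (d : X -> X -> R) (u : R -> X)
    (a b x y : R) :
  arc_length_param d u a b -> a <= x -> x < y -> y <= b ->
  d (u x) (u y) <= y - x.
Proof.
  intros h hx hxy hy; destruct (h x y hx ltac:(lra) hy) as [ub _].
  apply ub.
  assert (incr : forall i, (i < 1)%nat ->
    (fun i => match i with O => x | _ => y end) i
    < (fun i => match i with O => x | _ => y end) (S i)).
  { intros i hi; now replace i with 0%nat by lia. }
  exists (Partition x y 1 (fun i => match i with O => x | _ => y end)
            eq_refl eq_refl incr).
  unfold sum_over; simpl; ring.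
Qed.

Lemma partition_range {a b : R} (p : partition a b) (i : nat) :
  (i <= psize p)%nat -> a <= node p i <= b.
Proof.
  intros hi; split.
  - rewrite <- (node_first _ _ p) at 1; induction i as [| i IH]; [lra |].
    assert (l := node_incr _ _ p i ltac:(lia)); specialize (IH ltac:(lia)); lra.
  - rewrite <- (node_last _ _ p) at 2.
    set (n := psize p) in *; assert (hn : (n <= psize p)%nat) by (unfold n; lia).
    clearbody n; induction hi as [| n hi IH]; [lra |].
    assert (l := node_incr _ _ p n ltac:(lia)); specialize (IH ltac:(lia)); lra.
Qed.

Lemma partition_le {a b : R} (p : partition a b) : a <= b.
Proof.
  assert (h := partition_range p 0 ltac:(lia)).
  rewrite (node_first _ _ p) in h; lra.
Qed.

Section UnitSpeed.

Context (C C1 C2 C3 : R -> R3) (hC : is_C3 C C1 C2 C3).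

Lemma dist3_vdd1 (x y : R) : x < y ->
  dist3 (C x) (C y) = (y - x) * norm (vdd1 C x y).
Proof.
  intros h; unfold dist3.
  replace (minus (C x) (C y)) with (scal (- (y - x)) (vdd1 C x y)).
  - rewrite norm_scal_abs, Rabs_Ropp, Rabs_pos_eq by lra; trivial.
  - unfold vdd1, dd1; destruct (C x) as [[? ?] ?], (C y) as [[? ?] ?].
    apply R3_ext; intros [| [| j]]; vec; field; lra.
Qed.

Lemma near_chord_speed (x eps : R) : 0 < eps ->
  exists d, 0 < d /\ forall y z, x - d < y -> y < z -> z < x + d ->
    Rabs (norm (vdd1 C y z) - norm (C1 x)) < eps.
Proof.
  intros heps.
  assert (FF : Filter (near4 x)) by apply near4_filter.
  assert (hp : vlimF (near4 x) (fun q => vdd1 C (n0 q) (n1 q)) (C1 x)).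
  { apply near4_vdd1 with C2 C3; trivial; intros; lra. }
  apply limF_norm, (proj1 (limF_iff _ _ _)) with (eps := eps) in hp; trivial.
  destruct hp as [d [hd h]]; exists d; split; trivial; intros y z a b c.
  apply (h y z (z + (x + d - z) / 3) (z + (x + d - z) / 2)); lra.
Qed.

(** If the speed were smaller than one somewhere, then nearby all the inscribed
    polygonals, hence the arc itself, would be too short. *)
Lemma arc_length_unit_speed (c : R -> R3) (L x : R) :
  0 < L -> (forall s, 0 <= s <= L -> C s = c s) ->
  arc_length_param dist3 c 0 L -> 0 <= x <= L -> norm (C1 x) = 1.
Proof.
  intros hL e harc hx.
  assert (I : forall d, 0 < d -> exists y z, 0 <= y /\ y < z /\ z <= L /\
                x - d < y /\ z < x + d).
  { intros d hd; set (r := Rmin d L / 2).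
    assert (l1 := Rmin_l d L); assert (l2 := Rmin_r d L).
    assert (hr : 0 < Rmin d L) by now apply Rmin_glb_lt.
    destruct (Rle_lt_dec x (L / 2)).
    - exists x, (x + r); unfold r; repeat split; lra.
    - exists (x - r), x; unfold r; repeat split; lra. }
  apply Rle_antisym; apply Rnot_lt_le; intros hlt.
  - destruct (near_chord_speed x (norm (C1 x) - 1) ltac:(lra)) as [d [hd h]].
    destruct (I d hd) as [y [z [hy [hyz [hz [ly lz]]]]]].
    specialize (h y z ly hyz lz); apply Rabs_def2 in h.
    assert (hl := arc_length_lipschitz dist3 c 0 L y z harc hy hyz hz).
    rewrite <- !e, dist3_vdd1 in hl by lra.
    assert (hm : (z - y) * 1 < (z - y) * norm (vdd1 C y z))
      by (apply Rmult_lt_compat_l; lra).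
    lra.
  - set (r := (1 - norm (C1 x)) / 2).
    destruct (near_chord_speed x r) as [d [hd h]]; [unfold r; lra |].
    destruct (I d hd) as [y [z [hy [hyz [hz [ly lz]]]]]].
    destruct (harc y z hy ltac:(lra) hz) as [_ lub].
    assert (hle : z - y <= (1 - r) * (z - y)).
    { apply lub; intros t [p ->].
      assert (hs : forall m, (m <= psize p)%nat ->
        sum_over (seq 0 m) (fun i => dist3 (c (node p i)) (c (node p (S i))))
        <= (1 - r) * (node p m - node p 0)).
      { induction m as [| m IH]; intros hm.
        - unfold sum_over; simpl; lra.
        - rewrite sum_over_S; simpl; specialize (IH ltac:(lia)).
          assert (p1 := partition_range p m ltac:(lia)).
          assert (p2 := partition_range p (S m) ltac:(lia)).
          assert (p3 := node_incr _ _ p m ltac:(lia)).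
          rewrite <- (e (node p m)), <- (e (node p (S m))), dist3_vdd1
            by lra.
          specialize (h (node p m) (node p (S m)) ltac:(lra) p3 ltac:(lra)).
          apply Rabs_def2 in h.
          assert (q : (node p (S m) - node p m) * norm (vdd1 C (node p m)
                        (node p (S m))) <= (node p (S m) - node p m) * (1 - r)).
          { apply Rmult_le_compat_l; unfold r in *; lra. }
          lra. }
      eapply Rle_trans; [now apply hs |].
      rewrite (node_first _ _ p), (node_last _ _ p); lra. }
    assert (hr : 0 < r) by (unfold r; lra).
    nra.
Qed.

(** Unit speed makes the curve injective on short intervals, uniformly: hence a
    fine inscribed polygonal has no repeated consecutive vertices, and the
    modulus controls the mesh. *)
Lemma chord_lower_bound (M : R) :
  (forall x, 0 <= x <= M -> norm (C1 x) = 1) ->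
  exists d, 0 < d /\ forall x y, 0 <= x -> x < y -> y <= M -> y < x + d ->
    (y - x) / 2 <= dist3 (C x) (C y).
Proof.
  intros h1.
  destruct (uniform_on_segment M (fun a b => forall x y, a < x -> x < y ->
    y < b -> (y - x) / 2 <= dist3 (C x) (C y))) as [d [hd h]].
  - intros a b a' b' ha hb h x y hx hxy hy; apply h; lra.
  - intros x hx; destruct (near_chord_speed x (1 / 2) ltac:(lra))
      as [d [hd h]].
    exists d; split; trivial; intros y z hy hyz hz.
    specialize (h y z hy hyz hz); rewrite h1 in h by trivial.
    apply Rabs_def2 in h; rewrite dist3_vdd1 by trivial.
    unfold Rdiv; apply Rmult_le_compat_l; lra.
  - exists d; split; trivial; intros x y hx hxy hy hlt.
    apply (h x); lra.
Qed.

End UnitSpeed.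

(** * Mesh and modulus *)

(** The bound on the distances makes the least upper bound finite, so that its
    real part is not a dummy. *)
Lemma diam_le (c : R -> R3) (x y r : R) : x <= y ->
  (forall s s', x <= s <= y -> x <= s' <= y -> dist3 (c s) (c s') <= r) ->
  diam c x y <= r /\ forall s s', x <= s <= y -> x <= s' <= y ->
    dist3 (c s) (c s') <= diam c x y.
Proof.
  intros hxy h; unfold diam, Lub_Rbar.
  destruct (ex_lub_Rbar _) as [l [ub lub]]; simpl.
  assert (hr : Rbar_le l r).
  { apply lub; intros t [s [s' [hs [hs' ->]]]]; now apply h. }
  assert (hx : Rbar_le (dist3 (c x) (c x)) l).
  { apply ub; exists x, x; repeat split; lra. }
  destruct l as [l | |]; simpl in hr, hx |- *; try contradiction.
  split; trivial; intros s s' hs hs'; apply (ub (dist3 (c s) (c s'))).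
  now exists s, s'.
Qed.

Lemma fold_Rmax_ub (l : list R) (r x : R) : In x l -> x <= fold_right Rmax r l.
Proof.
  induction l as [| y l IH]; [contradiction |]; simpl; intros [-> | hi].
  - apply Rmax_l.
  - eapply Rle_trans; [now apply IH | apply Rmax_r].
Qed.

Lemma fold_Rmax_le (l : list R) (r b : R) :
  r <= b -> (forall x, In x l -> x <= b) -> fold_right Rmax r l <= b.
Proof.
  intros hr; induction l as [| y l IH]; simpl; intros h; trivial.
  apply Rmax_lub; [apply h; now left | apply IH; intros; apply h; now right].
Qed.

Lemma diam_le_modulus {a b : R} (c : R -> R3) (p : partition a b) (i : nat) :
  (i < psize p)%nat -> diam c (node p i) (node p (S i)) <= modulus c p.
Proof.
  intros hi; apply fold_Rmax_ub, in_map_iff.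
  exists i; split; trivial; apply in_seq; lia.
Qed.

Section Mesh.

Context (c : R -> R3) (L : R) (harc : arc_length_param dist3 c 0 L).

Lemma arc_dist3_le (s s' : R) :
  0 <= s <= L -> 0 <= s' <= L -> dist3 (c s) (c s') <= Rabs (s - s').
Proof.
  intros hs hs'; destruct (Rtotal_order s s') as [h | [<- | h]].
  - rewrite Rabs_left by lra; replace (- (s - s')) with (s' - s) by ring.
    apply (arc_length_lipschitz dist3 c 0 L); trivial; lra.
  - rewrite dist3_refl; apply Rabs_pos.
  - rewrite Rabs_right by lra; rewrite dist3_sym.
    apply (arc_length_lipschitz dist3 c 0 L); trivial; lra.
Qed.

Lemma arc_diam (x y : R) : 0 <= x -> x <= y -> y <= L ->
  diam c x y <= y - x /\ forall s s', x <= s <= y -> x <= s' <= y ->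
    dist3 (c s) (c s') <= diam c x y.
Proof.
  intros hx hxy hy; apply diam_le; trivial.
  intros s s' hs hs'; eapply Rle_trans; [apply arc_dist3_le; lra |].
  apply Rabs_le; lra.
Qed.

Lemma modulus_le_mesh {b : R} (p : partition 0 b) (r : R) :
  b <= L -> 0 <= r ->
  (forall i, (i < psize p)%nat -> node p (S i) - node p i <= r) ->
  modulus c p <= r.
Proof.
  intros hb hr h; apply fold_Rmax_le; trivial.
  intros x hx; apply in_map_iff in hx; destruct hx as [i [<- hi]].
  apply in_seq in hi; specialize (h i ltac:(lia)).
  assert (p1 := partition_range p i ltac:(lia)).
  assert (p2 := partition_range p (S i) ltac:(lia)).
  assert (p3 := node_incr _ _ p i ltac:(lia)).
  destruct (arc_diam (node p i) (node p (S i))) as [hd _]; lra.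
Qed.

(** An interval longer than [e] contains one of length [e / 2], whose chord is at
    least [e / 4]. *)
Lemma mesh_of_modulus (d : R) :
  0 < d -> (forall x y, 0 <= x -> x < y -> y <= L -> y < x + d ->
    (y - x) / 2 <= dist3 (c x) (c y)) ->
  forall (e b : R) (p : partition 0 b), 0 < e -> e <= d -> b <= L ->
    modulus c p < e / 4 ->
    forall i, (i < psize p)%nat -> node p (S i) < node p i + e.
Proof.
  intros hd hc e b p he hed hb hm i hi; apply Rnot_le_lt; intros hle.
  assert (p1 := partition_range p i ltac:(lia)).
  assert (p2 := partition_range p (S i) ltac:(lia)).
  assert (p3 := diam_le_modulus c p i hi).
  destruct (arc_diam (node p i) (node p (S i))) as [_ h]; try lra.
  specialize (h (node p i) (node p i + e / 2) ltac:(lra) ltac:(lra)).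
  specialize (hc (node p i) (node p i + e / 2)
                ltac:(lra) ltac:(lra) ltac:(lra) ltac:(lra)).
  lra.
Qed.

End Mesh.

(** * Inscribed polygonals *)

Lemma discard_repeated_id (l : list R3) :
  (forall i, (S i < length l)%nat -> nth i l zero <> nth (S i) l zero) ->
  discard_repeated l = l.
Proof.
  induction l as [| x [| y l] IH]; trivial; intros h.
  change (discard_repeated (x :: y :: l)) with
    (if R3_eq_dec x y then discard_repeated (y :: l)
     else x :: discard_repeated (y :: l)).
  destruct (R3_eq_dec x y) as [e | _].
  - exfalso; apply (h 0%nat); [simpl; lia | exact e].
  - f_equal; apply IH; intros i hi; apply (h (S i)); simpl in *; lia.
Qed.

Lemma nth_map_seq (f : nat -> R3) (n i : nat) :
  (i < n)%nat -> nth i (map f (seq 0 n)) zero = f i.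
Proof.
  intros hi; rewrite nth_indep with (d' := f 0%nat)
    by (rewrite length_map, length_seq; lia).
  rewrite (map_nth f), seq_nth by lia; reflexivity.
Qed.

Section Inscribed.

Context {b : R} (c : R -> R3) (p : partition 0 b)
  (hdist : forall i, (i < psize p)%nat -> c (node p i) <> c (node p (S i))).

Lemma inscribed_eq :
  inscribed c p = map (fun i => c (node p i)) (seq 0 (S (psize p))).
Proof.
  apply discard_repeated_id; rewrite length_map, length_seq.
  intros i hi; rewrite !nth_map_seq by lia; apply hdist; lia.
Qed.

Lemma nsegs_inscribed : nsegs (inscribed c p) = psize p.
Proof.
  unfold nsegs; rewrite inscribed_eq, length_map, length_seq; lia.
Qed.

Lemma nth_inscribed (i : nat) :
  (i <= psize p)%nat -> nth i (inscribed c p) zero = c (node p i).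
Proof.
  intros hi; rewrite inscribed_eq.
  now rewrite (nth_map_seq (fun i => c (node p i))) by lia.
Qed.

(** A closed polygonal is unrolled along the periodic extension of the curve,
    two nodes beyond the period, so that its cyclic sum becomes one over
    consecutive nodes. *)
Definition unrolled_node (i : nat) : R :=
  if le_lt_dec i (psize p) then node p i else b + node p (i - psize p).

Definition last_node (k : kind) : nat :=
  match k with Arc => psize p | Closed => psize p + 2 end.

Lemma unrolled_node_inner (i : nat) :
  (i <= psize p)%nat -> unrolled_node i = node p i.
Proof. intros hi; unfold unrolled_node; destruct (le_lt_dec _ _); trivial; lia. Qed.

Lemma unrolled_node_outer (i : nat) : unrolled_node (psize p + i) = b + node p i.
Proof.
  unfold unrolled_node; destruct (le_lt_dec _ _).
  - replace i with 0%nat by lia; rewrite Nat.add_0_r.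
    rewrite (node_last _ _ p), (node_first _ _ p); ring.
  - f_equal; f_equal; lia.
Qed.

Lemma last_node_narcs (k : kind) : (2 <= psize p)%nat ->
  last_node k = S (S (narcs k (inscribed c p))).
Proof.
  intros h; unfold last_node, narcs; rewrite nsegs_inscribed.
  destruct k; lia.
Qed.

Lemma unrolled_node_fine (k : kind) (d : R) : (2 <= psize p)%nat ->
  fine_nodes d (psize p) (node p) -> fine_nodes d (last_node k) unrolled_node.
Proof.
  intros h2 h i hi.
  destruct (le_lt_dec (psize p) i) as [l | l].
  - replace i with (psize p + (i - psize p))%nat by lia.
    replace (S (psize p + (i - psize p))) with (psize p + S (i - psize p))%nat
      by lia.
    rewrite !unrolled_node_outer.
    assert (hi' : (i - psize p < psize p)%nat)
      by (unfold last_node in hi; destruct k; lia).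
    specialize (h _ hi'); lra.
  - rewrite !unrolled_node_inner by lia; now apply h.
Qed.

Context (k : kind) (C : R -> R3)
  (hC : forall x, 0 <= x <= b -> C x = c x)
  (hk : k = Closed -> shift_agrees b C c)
  (hn : (3 <= psize p)%nat).

Lemma vertex_unrolled (i : nat) : (i <= last_node k)%nat ->
  vertex k (inscribed c p) i = C (unrolled_node i).
Proof.
  assert (hb := partition_le p).
  assert (inner : forall i, (i <= psize p)%nat ->
            C (unrolled_node i) = c (node p i)).
  { intros j hj; rewrite unrolled_node_inner by trivial.
    now apply hC, partition_range. }
  intros hi; destruct k; simpl in hi.
  - unfold vertex; rewrite nth_inscribed by trivial; symmetry; now apply inner.
  - unfold vertex; rewrite nsegs_inscribed.
    specialize (hk eq_refl).
    destruct (le_lt_dec (psize p) i) as [l | l].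
    + replace i with (i - psize p + 1 * psize p)%nat at 1 by lia.
      rewrite Nat.Div0.mod_add, Nat.mod_small by lia.
      rewrite nth_inscribed by lia.
      replace i with (psize p + (i - psize p))%nat at 2 by lia.
      rewrite unrolled_node_outer, Rplus_comm; symmetry; apply hk.
      apply partition_range; lia.
    + rewrite Nat.mod_small, nth_inscribed by lia; symmetry; apply inner; lia.
Qed.

Lemma seg_cross_unrolled (i : nat) : (S (S i) <= last_node k)%nat ->
  seg_cross k (inscribed c p) (S i)
  = seg3 C (unrolled_node i) (unrolled_node (S i)) (unrolled_node (S (S i))).
Proof.
  intros hi; unfold seg_cross, segment.
  replace (S i - 1)%nat with i by lia; replace (S (S i) - 1)%nat with (S i) by lia.
  rewrite !vertex_unrolled by lia; reflexivity.
Qed.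

Lemma binormal_unrolled (i : nat) : (S (S i) <= last_node k)%nat ->
  seg3 C (unrolled_node i) (unrolled_node (S i)) (unrolled_node (S (S i)))
  <> zero ->
  binormal k (inscribed c p) (S i) = node_binormal C unrolled_node (S i).
Proof.
  intros hi n; rewrite <- seg_cross_unrolled in n by trivial.
  unfold node_binormal; replace (S i - 1)%nat with i by lia.
  rewrite <- seg_cross_unrolled by trivial; cbn [binormal].
  destruct (R3_eq_dec (seg_cross k (inscribed c p) (S i)) zero) as [e | _].
  - now destruct n.
  - reflexivity.
Qed.

Lemma arcs_length_unrolled (m : nat) :
  (forall i, (S (S i) <= last_node k)%nat ->
     seg3 C (unrolled_node i) (unrolled_node (S i)) (unrolled_node (S (S i)))
     <> zero) ->
  (S (S m) <= last_node k)%nat ->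
  arcs_length k (inscribed c p) m = node_torsion C unrolled_node m.
Proof.
  intros n hm; unfold arcs_length, node_torsion, sum_over; f_equal.
  apply map_ext_in; intros i hi; apply in_seq in hi.
  destruct i as [| [| i]]; try lia.
  replace (S (S i) - 1)%nat with (S i) by lia.
  now rewrite !binormal_unrolled by (try apply n; lia).
Qed.

End Inscribed.

Lemma sum_over_nonneg (a m : nat) (f : nat -> R) :
  (forall i, 0 <= f i) -> 0 <= sum_over (seq a m) f.
Proof.
  intros h; induction m as [| m IH]; [unfold sum_over; simpl; lra |].
  rewrite sum_over_S; specialize (h (a + m)%nat); lra.
Qed.

Lemma sum_over_monotone (a m m' : nat) (f : nat -> R) :
  (forall i, 0 <= f i) -> (m <= m')%nat ->
  sum_over (seq a m) f <= sum_over (seq a m') f.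
Proof.
  intros h hm; induction hm as [| m' hm IH]; [lra |].
  rewrite sum_over_S; specialize (h (a + m')%nat); lra.
Qed.

(** Consecutive minimal arcs can be glued: at a junction both candidates take
    the value of the common end point. *)
Lemma binormal_indicatrix_exists (k : kind) (P : list R3) :
  exists u, is_binormal_indicatrix k P u.
Proof.
  unfold is_binormal_indicatrix; generalize (narcs k P) as N.
  assert (dpos : forall i,
    0 <= dRP2 (cls (binormal k P (i - 1))) (cls (binormal k P i)))
    by (intros; apply dRP2_bounds).
  assert (mono : forall m m', (m <= m')%nat ->
            arcs_length k P m <= arcs_length k P m')
    by (intros; now apply sum_over_monotone).
  induction N as [| N [u [hu1 hu2]]].
  - exists (fun _ => cls (binormal k P 1)); split.
    + intros m hm; now replace m with 0%nat by lia.
    + intros m hm; lia.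
  - destruct (minimal_geodesic (cls (binormal k P (S N)))
      (cls (binormal k P (S (S N))))) as [g [g0 [g1 gd]]].
    set (A := arcs_length k P) in *.
    assert (hA : A (S N) = A N + dRP2 (cls (binormal k P (S N)))
                                  (cls (binormal k P (S (S N))))).
    { unfold A, arcs_length; now rewrite sum_over_S. }
    set (v := fun x => if Rle_dec x (A N) then u x else g (x - A N)).
    assert (left_part : forall x, x <= A N -> v x = u x).
    { intros x hx; unfold v; now destruct (Rle_dec x (A N)). }
    assert (right_part : forall x, A N <= x -> v x = g (x - A N)).
    { intros x hx; unfold v; destruct (Rle_dec x (A N)); trivial.
      replace x with (A N) by lra; rewrite Rminus_diag, g0; now apply hu1. }
    exists v; split.
    + intros m hm; destruct (le_lt_dec m N) as [l | l].
      * rewrite left_part by now apply mono.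
        now apply hu1.
      * replace m with (S N) by lia; rewrite right_part by (apply mono; lia).
        replace (A (S N) - A N) with (dRP2 (cls (binormal k P (S N)))
          (cls (binormal k P (S (S N))))) by lra; exact g1.
    + intros m hm x y hx hy; destruct (le_lt_dec (S m) N) as [l | l].
      * assert (h := mono (S m) N l).
        rewrite !left_part by lra; now apply hu2 with m.
      * replace m with N in * by lia; rewrite !right_part by lra.
        rewrite gd by lra; f_equal; ring.
Qed.

Lemma fine_nodes_size (b d : R) (p : partition 0 b) (n : nat) :
  0 < b -> INR n * d <= b -> 0 < d -> fine_nodes d (psize p) (node p) ->
  (n <= psize p)%nat.
Proof.
  intros hb hd hd0 h.
  assert (H : forall m, (m <= psize p)%nat -> node p m <= INR m * d).
  { induction m as [| m IH]; intros hm.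
    - rewrite (node_first _ _ p); simpl; lra.
    - specialize (IH ltac:(lia)); specialize (h m ltac:(lia)).
      rewrite S_INR; lra. }
  specialize (H (psize p) (le_n _)); rewrite (node_last _ _ p) in H.
  apply INR_le; apply Rmult_le_reg_r with d; lra.
Qed.

Lemma uniform_node_last (b : R) (n : nat) : INR (S n) * (b / INR (S n)) = b.
Proof. assert (h := lt_0_INR (S n) (Nat.lt_0_succ n)); field; lra. Qed.

Lemma uniform_node_incr (b : R) (hb : 0 < b) (n i : nat) :
  INR i * (b / INR (S n)) < INR (S i) * (b / INR (S n)).
Proof.
  apply Rmult_lt_compat_r; [| apply lt_INR; lia].
  apply Rdiv_lt_0_compat; trivial; apply lt_0_INR; lia.
Qed.

Definition uniform_partition (b : R) (hb : 0 < b) (n : nat) : partition 0 b :=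
  Partition 0 b (S n) (fun i => INR i * (b / INR (S n)))
    (Rmult_0_l _) (uniform_node_last b n) (fun i _ => uniform_node_incr b hb n i).

Lemma uniform_partition_mesh (b : R) (hb : 0 < b) (n i : nat) :
  node (uniform_partition b hb n) (S i) - node (uniform_partition b hb n) i
  = b / INR (S n).
Proof. unfold node, uniform_partition; rewrite (S_INR i); ring. Qed.

Lemma inv_INR_small (b eps : R) : 0 < b -> 0 < eps ->
  exists n0, forall n, (n0 <= n)%nat -> b / INR (S n) < eps.
Proof.
  intros hb heps; destruct (INR_unbounded (b / eps)) as [n0 h].
  exists n0; intros n hn.
  assert (h1 : INR n0 < INR (S n)) by (apply lt_INR; lia).
  assert (h0 := lt_0_INR (S n) (Nat.lt_0_succ n)).
  apply Rmult_lt_reg_r with (INR (S n) / eps); [now apply Rdiv_lt_0_compat |].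
  replace (b / INR (S n) * (INR (S n) / eps)) with (b / eps) by (field; lra).
  replace (eps * (INR (S n) / eps)) with (INR (S n)) by (field; lra).
  lra.
Qed.

Lemma bracketing_node {b : R} (p : partition 0 b) (s : R) :
  0 <= s <= b -> (1 <= psize p)%nat ->
  exists j, (j < psize p)%nat /\ node p j <= s <= node p (S j).
Proof.
  intros hs h1.
  assert (H : forall m, (1 <= m <= psize p)%nat -> s <= node p m ->
    exists j, (j < psize p)%nat /\ node p j <= s <= node p (S j)).
  { induction m as [| m IH]; intros hm hle; [lia |].
    destruct (Rle_lt_dec (node p m) s) as [l | l].
    - exists m; repeat split; trivial; lia.
    - destruct m as [| m]; [| apply IH; [lia | lra]].
      rewrite (node_first _ _ p) in l; lra. }
  apply (H (psize p)); [lia | rewrite (node_last _ _ p); lra].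
Qed.

(** * The polygonals inscribed in a curve of class C3 *)

Section Curve.

Context (k : kind) (L : R) (c : R -> R3) (C C1 C2 C3 : R -> R3)
  (hL : 0 < L) (hC : is_C3 C C1 C2 C3)
  (hCc : forall x, 0 <= x <= L -> C x = c x)
  (harc : arc_length_param dist3 c 0 L)
  (theta F : R -> R) (htheta : forall x, continuous theta x)
  (hF : forall x, is_derive F x (theta x)) (hF0 : F 0 = 0)
  (M : R)
  (hosc : forall x, 0 <= x <= M -> osc_normal C1 C2 x <> zero)
  (hat : forall x, 0 <= x <= M -> theta x = abs_torsion C1 C2 C3 x)
  (b : R) (hb : 0 < b <= L) (hM : b <= M)
  (hk : k = Closed -> b = L /\ M = 2 * L /\ shift_agrees L C c).

(** The binormals and the partial sums of an inscribed polygonal are compared with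
    the curve at the nodes [1, ..., n - 1], where both kinds of polygonal have the
    same binormals. *)
Lemma polygonal_estimate (eps : R) : 0 < eps -> exists d, 0 < d /\
  forall p : partition 0 b, modulus c p < d ->
    (3 <= psize p)%nat /\
    (forall i, (i < psize p)%nat -> node p (S i) < node p i + eps) /\
    (forall i, (1 <= i)%nat -> (i < psize p)%nat ->
       dist3 (S2val (binormal k (inscribed c p) i))
             (S2val (normalize (osc_normal C1 C2 (node p i)))) <= eps /\
       Rabs (arcs_length k (inscribed c p) (i - 1) - F (node p i)) <= eps /\
       (i - 1 <= narcs k (inscribed c p))%nat) /\
    Rabs (polyTAT k (inscribed c p) - F b) <= eps.
Proof.
  intros heps; assert (he2 : 0 < eps / 2) by lra.
  destruct (node_estimate C C1 C2 C3 hC theta F htheta hF M ltac:(lra) hosc hat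
    (eps / 2) he2) as [d1 [p1 h1]].
  destruct (chord_lower_bound C C1 C2 C3 hC L) as [d2 [p2 h2]].
  { intros x hx; now apply (arc_length_unit_speed C C1 C2 C3 hC c L). }
  assert (hFc : continuous F b)
    by (apply (ex_derive_continuous (V := R_NormedModule)); now exists (theta b)).
  destruct (proj1 (filterlim_locally _ _) hFc (mkposreal _ he2)) as [d3 h3].
  (* the bound [b / 4] on the mesh forces at least four segments *)
  set (e := Rmin (Rmin d1 d2) (Rmin (Rmin d3 eps) (b / 4))).
  assert (l1 : e <= Rmin d1 d2) by apply Rmin_l.
  assert (l2 : e <= Rmin (Rmin d3 eps) (b / 4)) by apply Rmin_r.
  assert (l3 := Rmin_l d1 d2); assert (l4 := Rmin_r d1 d2).
  assert (l5 := Rmin_l (Rmin d3 eps) (b / 4)).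
  assert (l6 := Rmin_r (Rmin d3 eps) (b / 4)).
  assert (l7 := Rmin_l d3 eps); assert (l8 := Rmin_r d3 eps).
  assert (he : 0 < e)
    by (repeat apply Rmin_glb_lt; try lra; apply cond_pos).
  exists (e / 4); split; [lra |]; intros p hp.
  assert (h2' : forall x y, 0 <= x -> x < y -> y <= L -> y < x + d2 ->
            (y - x) / 2 <= dist3 (c x) (c y)).
  { intros x y hx hxy hy hlt; rewrite <- !hCc by lra; now apply h2. }
  assert (mesh := mesh_of_modulus c L harc d2 p2 h2' e b p he ltac:(lra)
                    ltac:(lra) hp).
  assert (fine : fine_nodes e (psize p) (node p)).
  { intros i hi; split; [now apply node_incr | now apply mesh]. }
  assert (h4 : (4 <= psize p)%nat).
  { apply (fine_nodes_size b e); trivial; try lra.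
    replace (INR 4) with 4 by (simpl; ring); lra. }
  assert (hdist : forall i, (i < psize p)%nat ->
            c (node p i) <> c (node p (S i))).
  { intros i hi E; assert (f := fine i hi).
    assert (r1 := partition_range p i ltac:(lia)).
    assert (r2 := partition_range p (S i) ltac:(lia)).
    specialize (h2' (node p i) (node p (S i))).
    rewrite E, dist3_refl in h2'; lra. }
  set (X := unrolled_node p) in *; set (P := inscribed c p) in *.
  assert (fineX : fine_nodes d1 (last_node p k) X).
  { intros i hi; assert (f : X i < X (S i) < X i + e); [| lra].
    now apply (unrolled_node_fine p k e ltac:(lia) fine). }
  assert (X0 : X 0%nat = 0).
  { unfold X; rewrite unrolled_node_inner by lia; apply node_first. }
  assert (XN : X (last_node p k) <= M).
  { unfold X, last_node; destruct k.
    - rewrite unrolled_node_inner, (node_last _ _ p) by lia; lra.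
    - destruct (hk eq_refl) as [eb [eM _]]; rewrite unrolled_node_outer.
      assert (r := partition_range p 2 ltac:(lia)); lra. }
  destruct (h1 (last_node p k) X fineX ltac:(lra) XN) as [turn arc].
  assert (hCb : forall x, 0 <= x <= b -> C x = c x) by (intros; apply hCc; lra).
  assert (hkb : k = Closed -> shift_agrees b C c).
  { intros ek; destruct (hk ek) as [-> [_ s]]; exact s. }
  assert (turn' : forall i, (S (S i) <= last_node p k)%nat ->
            seg3 C (X i) (X (S i)) (X (S (S i))) <> zero)
    by (intros i hi; now apply turn).
  assert (hN := last_node_narcs c p hdist k ltac:(lia)).
  assert (hlast : (psize p <= last_node p k)%nat)
    by (unfold last_node; destruct k; lia).
  assert (len : forall m, (S (S m) <= last_node p k)%nat ->
            Rabs (arcs_length k P m - F (X (S m))) <= eps / 2).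
  { intros m hm; specialize (arc m hm); rewrite X0, hF0, Rminus_0_r in arc.
    unfold P; rewrite (arcs_length_unrolled c p hdist k C) ; trivial; lia. }
  repeat split; [lia | | | | |].
  - intros i hi; specialize (fine i hi); lra.
  - destruct i as [| i]; [lia |].
    unfold P; rewrite (binormal_unrolled c p hdist k C); trivial;
      [| lia | lia | apply turn'; lia].
    rewrite <- (unrolled_node_inner p (S i)) by lia.
    eapply Rle_trans; [apply turn; lia | lra].
  - destruct i as [| i]; [lia |]; replace (S i - 1)%nat with i by lia.
    rewrite <- (unrolled_node_inner p (S i)) by lia.
    eapply Rle_trans; [apply len; lia | lra].
  - fold P in hN; lia.
  - specialize (len (narcs k P) ltac:(fold P in hN; lia)).
    fold (polyTAT k P) in len.
    (* the sum ends one interval before or after the end point [b] *)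
    assert (hend : Rabs (X (S (narcs k P)) - b) < d3).
    { assert (EN : S (narcs k P) = (last_node p k - 1)%nat)
        by (fold P in hN; lia).
      rewrite EN; unfold X, last_node; destruct k.
      - rewrite unrolled_node_inner by lia.
        assert (f := fine (psize p - 1)%nat ltac:(lia)).
        replace (S (psize p - 1)) with (psize p) in f by lia.
        rewrite (node_last _ _ p) in f; apply Rabs_def1; lra.
      - replace (psize p + 2 - 1)%nat with (psize p + 1)%nat by lia.
        rewrite unrolled_node_outer; assert (f := fine 0%nat ltac:(lia)).
        rewrite (node_first _ _ p) in f; apply Rabs_def1; lra. }
    specialize (h3 _ hend).
    change (Rabs (F (X (S (narcs k P))) - F b) < eps / 2) in h3.
    apply Rabs_def2 in h3; apply Rabs_le_between in len; apply Rabs_le; lra.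
Qed.

Lemma uniform_partition_modulus (h : 0 < b) (n : nat) :
  modulus c (uniform_partition b h n) <= b / INR (S n).
Proof.
  apply (modulus_le_mesh c L harc); [lra | |].
  - left; apply Rdiv_lt_0_compat; [lra | apply lt_0_INR; lia].
  - intros i _; rewrite uniform_partition_mesh; lra.
Qed.

(** The upper bound comes from the estimate for all fine polygonals, the lower one
    from uniform partitions. *)
Lemma TAT_eq : TAT k c 0 b = Finite (F b).
Proof.
  apply (is_Rbar_lim_right0_unique (TAT_sup k c 0 b)); [apply TAT_correct |].
  assert (low : forall e, 0 < e -> Rbar_le (F b) (TAT_sup k c 0 b e)).
  { intros e he; apply Rbar_not_lt_le; intros hlt.
    assert (ub : forall p : partition 0 b, modulus c p < e ->
      Rbar_le (polyTAT k (inscribed c p)) (TAT_sup k c 0 b e)).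
    { intros p hp; unfold TAT_sup, Lub_Rbar.
      destruct (ex_lub_Rbar _) as [l [hu hu']]; simpl; apply hu.
      now exists p. }
    assert (H : forall eps, 0 < eps -> exists p : partition 0 b,
      modulus c p < e /\ Rabs (polyTAT k (inscribed c p) - F b) <= eps).
    { intros eps heps; destruct (polygonal_estimate eps heps) as [d [hd hp]].
      destruct (inv_INR_small b (Rmin d e)) as [n hn];
        [lra | now apply Rmin_glb_lt |].
      specialize (hn n (le_n n)).
      assert (m := uniform_partition_modulus (proj1 hb) n).
      assert (m1 := Rmin_l d e); assert (m2 := Rmin_r d e).
      exists (uniform_partition b (proj1 hb) n); split; [lra |].
      apply hp; lra. }
    destruct (TAT_sup k c 0 b e) as [r | |]; simpl in hlt; try contradiction.
    - destruct (H ((F b - r) / 2) ltac:(lra)) as [p [hp hp']].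
      specialize (ub p hp); simpl in ub; apply Rabs_le_between in hp'; lra.
    - destruct (H 1 Rlt_0_1) as [p [hp _]]; exact (ub p hp). }
  split.
  - intros x hx; exists (mkposreal 1 Rlt_0_1); intros e _ he.
    eapply Rbar_lt_le_trans; [apply hx | now apply low].
  - intros y hy.
    assert (hr : exists eps, 0 < eps /\ Rbar_lt (F b + eps) y).
    { destruct y as [y | |]; simpl in hy; try contradiction.
      - exists ((y - F b) / 2); simpl; lra.
      - exists 1; simpl; split; trivial; lra. }
    destruct hr as [eps [heps hr]].
    destruct (polygonal_estimate eps heps) as [d [hd hp]].
    exists (mkposreal d hd); intros e he he0.
    change (Rabs (e - 0) < d) in he; rewrite Rminus_0_r in he.
    rewrite Rabs_pos_eq in he by lra.
    eapply Rbar_le_lt_trans; [| apply hr].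
    unfold TAT_sup, Lub_Rbar; destruct (ex_lub_Rbar _) as [l [ub lub]]; simpl.
    apply lub; intros r [p [hm ->]]; simpl.
    destruct (hp p ltac:(lra)) as [_ [_ [_ h]]].
    apply Rabs_le_between in h; lra.
Qed.

End Curve.

(** * The weak binormal along the curve *)

Lemma dRP2_sym (p q : RP2) : dRP2 p q = dRP2 q p.
Proof.
  destruct (RP2_ind_cls p) as [y ->], (RP2_ind_cls q) as [z ->].
  rewrite !dRP2_acos; do 2 f_equal.
  destruct (S2val y) as [[? ?] ?], (S2val z) as [[? ?] ?]; simpl; ring.
Qed.

Lemma RP2_arc_lipschitz (u : R -> RP2) (a b x y : R) :
  arc_length_param dRP2 u a b -> a <= x <= b -> a <= y <= b ->
  dRP2 (u x) (u y) <= Rabs (x - y).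
Proof.
  intros h hx hy; destruct (Rtotal_order x y) as [l | [<- | l]].
  - rewrite Rabs_left by lra; replace (- (x - y)) with (y - x) by ring.
    apply (arc_length_lipschitz dRP2 u a b); trivial; lra.
  - rewrite dRP2_refl; apply Rabs_pos.
  - rewrite Rabs_right by lra; rewrite dRP2_sym.
    apply (arc_length_lipschitz dRP2 u a b); trivial; lra.
Qed.

Lemma osc_continuous (C C1 C2 C3 : R -> R3) (x : R) :
  is_C3 C C1 C2 C3 -> vlimF (locally x) (osc_normal C1 C2) (osc_normal C1 C2 x).
Proof.
  intros hC; apply vlimF_cross; try apply locally_filter;
    intros j; apply (C_continuous C C1 C2 C3 hC j x).
Qed.

Section WeakBinormal.

Context (k : kind) (L : R) (c : R -> R3) (C C1 C2 C3 : R -> R3)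
  (hL : 0 < L) (hC : is_C3 C C1 C2 C3)
  (hCc : forall x, 0 <= x <= L -> C x = c x)
  (harc : arc_length_param dist3 c 0 L)
  (theta F : R -> R) (htheta : forall x, continuous theta x)
  (hF : forall x, is_derive F x (theta x)) (hF0 : F 0 = 0)
  (M : R) (hM : L <= M)
  (hosc : forall x, 0 <= x <= M -> osc_normal C1 C2 x <> zero)
  (hat : forall x, 0 <= x <= M -> theta x = abs_torsion C1 C2 C3 x)
  (hk : k = Closed -> M = 2 * L /\ shift_agrees L C c).

Lemma near_binormal_and_length (s eps : R) : 0 <= s <= L -> 0 < eps ->
  exists d, 0 < d /\ forall x, Rabs (x - s) < d ->
    dist3 (S2val (normalize (osc_normal C1 C2 s)))
          (S2val (normalize (osc_normal C1 C2 x))) <= eps /\ Rabs (F x - F s) <= eps.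
Proof.
  intros hs heps.
  destruct (vlimF_normalize (locally s) _ _ (osc_continuous C C1 C2 C3 s hC)
    (hosc s ltac:(lra))) as [_ lim].
  assert (hFc : continuous F s)
    by (apply (ex_derive_continuous (V := R_NormedModule)); now exists (theta s)).
  assert (H : forall j, locally s (fun x =>
    Rabs (coord j (S2val (normalize (osc_normal C1 C2 x)))
          - coord j (S2val (normalize (osc_normal C1 C2 s)))) < eps / 3)).
  { intros j; apply (proj1 (limF_iff _ _ _) (lim j)); lra. }
  assert (HF : locally s (fun x => Rabs (F x - F s) < eps))
    by (apply (proj1 (limF_iff (locally s) F (F s)) hFc); lra).
  destruct (filter_and _ _ HF (filter_and _ _ (H 0%nat)
    (filter_and _ _ (H 1%nat) (H 2%nat)))) as [d hd].
  exists d; split; [apply cond_pos |]; intros x hx.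
  destruct (hd x hx) as [h [h0 [h1 h2]]]; split; [| lra].
  rewrite dist3_sym; replace eps with (3 * (eps / 3)) by field.
  apply dist3_coords; intros [| [| j]]; left; trivial.
Qed.

(** At a node the indicatrix of a fine inscribed polygonal takes the value of a
    discrete binormal, which is close to the binormal of the curve, at a
    parameter close to the absolute torsion of the curve up to that node. *)
Lemma weak_binormal_value (bc : R -> RP2) (s : R) :
  0 < F L -> is_weak_binormal k c 0 L (F L) bc -> 0 <= s <= L -> 0 <= F s <= F L ->
  bc (F s) = cls (normalize (osc_normal C1 C2 s)).
Proof.
  intros hT [barc bconv] hs hFs; symmetry.
  destruct (RP2_ind_cls (bc (F s))) as [v ev]; rewrite ev.
  apply cls_eq_limit; intros eps heps.
  destruct (near_binormal_and_length s (eps / 7) hs ltac:(lra))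
    as [d0 [p0 near]].
  set (e := Rmin (eps / 7) (Rmin (d0 / 2) (F L / 2))).
  assert (l1 : e <= eps / 7) by apply Rmin_l.
  assert (l2 : e <= Rmin (d0 / 2) (F L / 2)) by apply Rmin_r.
  assert (l3 := Rmin_l (d0 / 2) (F L / 2)).
  assert (l4 := Rmin_r (d0 / 2) (F L / 2)).
  assert (he : 0 < e) by (repeat apply Rmin_glb_lt; lra).
  destruct (polygonal_estimate k L c C C1 C2 C3 hL hC hCc harc theta F htheta hF
    hF0 M hosc hat L ltac:(lra) hM
    (fun ek => conj eq_refl (hk ek)) e he) as [d [pd est]].
  set (P := uniform_partition L hL).
  set (u := fun h => proj1_sig (constructive_indefinite_description _
                       (binormal_indicatrix_exists k (inscribed c (P h))))).
  assert (hu : forall h, is_binormal_indicatrix k (inscribed c (P h)) (u h)).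
  { intros h; unfold u.
    now destruct (constructive_indefinite_description _ _). }
  assert (hmod : forall h, modulus c (P h) <= L / INR (S h)).
  { intros h; apply (uniform_partition_modulus L c harc L); lra. }
  assert (hlim : is_lim_seq (fun h => modulus c (P h)) 0).
  { apply is_lim_seq_spec; intros r.
    destruct (inv_INR_small L r hL (cond_pos r)) as [n0 hn].
    exists n0; intros n hle; specialize (hn n hle); specialize (hmod n).
    assert (h0 : 0 <= modulus c (P n)).
    { eapply Rle_trans; [| apply (diam_le_modulus c (P n) 0); simpl; lia].
      assert (q0 := partition_range (P n) 0 ltac:(simpl; lia)).
      assert (q1 := partition_range (P n) 1 ltac:(simpl; lia)).
      assert (q2 := node_incr _ _ (P n) 0 ltac:(simpl; lia)).
      destruct (arc_diam c L harc (node (P n) 0) (node (P n) 1)) as [_ hd];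
        try lra.
      eapply Rle_trans; [| apply (hd (node (P n) 0) (node (P n) 0)); lra].
      apply dist3_ge0. }
    rewrite Rminus_0_r, Rabs_pos_eq; lra. }
  destruct (bconv P u hlim hu (eps / 7) ltac:(lra)) as [N hN].
  destruct (inv_INR_small L d hL pd) as [n0 hn].
  set (h := Nat.max N n0).
  specialize (hn h (Nat.le_max_r _ _)); specialize (hmod h).
  specialize (hN h (Nat.le_max_l _ _)); specialize (hu h).
  destruct hu as [hu _].
  set (p := P h) in *; set (Q := inscribed c p) in *.
  destruct (est p ltac:(lra)) as [size [mesh [nodes tot]]].
  fold Q in nodes, tot.
  destruct (bracketing_node p s hs ltac:(lia)) as [j [hj hjs]].
  (* the binormals start at the index 1 *)
  assert (hi : exists i, (1 <= i)%nat /\ (i < psize p)%nat /\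
                 Rabs (node p i - s) < d0).
  { destruct j as [| j].
    - exists 1%nat; assert (m0 := mesh 0%nat ltac:(lia)).
      repeat split; [lia | lia | apply Rabs_def1; lra].
    - exists (S j); assert (m0 := mesh (S j) hj).
      repeat split; [lia | lia | apply Rabs_def1; lra]. }
  destruct hi as [i [hi1 [hin his]]].
  destruct (nodes i hi1 hin) as [nb [nl nn]].
  destruct (near (node p i) his) as [near_b near_F].
  set (A := arcs_length k Q (i - 1)) in *; set (T' := polyTAT k Q) in *.
  assert (hA0 : 0 <= A) by (apply sum_over_nonneg; intros; apply dRP2_bounds).
  assert (hAT : A <= T')
    by (apply sum_over_monotone; trivial; intros; apply dRP2_bounds).
  apply Rabs_le_between in tot, nl, near_F.
  assert (hT' : 0 < T') by lra.
  set (x := A * F L / T').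
  assert (hr : 0 <= A / T' <= 1).
  { split; [apply Rmult_le_pos; [trivial | left; now apply Rinv_0_lt_compat] |].
    apply Rmult_le_reg_r with T'; trivial; unfold Rdiv.
    rewrite Rmult_assoc, Rinv_l; lra. }
  assert (hx : 0 <= x <= F L).
  { unfold x; replace (A * F L / T') with (A / T' * F L) by (field; lra).
    split; nra. }
  assert (hxA : Rabs (x - A) <= e).
  { replace (x - A) with (A / T' * (F L - T')) by (unfold x; field; lra).
    rewrite Rabs_mult, (Rabs_pos_eq (A / T')) by lra.
    assert (q : Rabs (F L - T') <= e) by (apply Rabs_le; lra).
    assert (q0 := Rabs_pos (F L - T')); nra. }
  apply Rabs_le_between in hxA.
  assert (close := hN x hx).
  replace (T' * x / F L) with A in close by (unfold x; field; lra).
  unfold A in close; rewrite hu in close by trivial; fold A in close.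
  replace (S (i - 1)) with i in close by lia.
  destruct (close_representative (binormal k Q i) (bc x)) as [z1 [e1 c1]].
  destruct (close_representative z1 (bc (F s))) as [z2 [e2 c2]].
  rewrite e1 in c2.
  assert (lip := RP2_arc_lipschitz bc 0 (F L) x (F s) barc hx hFs).
  assert (hxs : Rabs (x - F s) <= 3 * (eps / 7)) by (apply Rabs_le; lra).
  exists z2; split; [congruence |].
  set (y := S2val (normalize (osc_normal C1 C2 s))) in *.
  set (y' := S2val (normalize (osc_normal C1 C2 (node p i)))) in *.
  set (w := S2val (binormal k Q i)) in *.
  assert (t1 := dist3_triangle y y' (S2val z2)).
  assert (t2 := dist3_triangle y' w (S2val z2)).
  assert (t3 := dist3_triangle w (S2val z1) (S2val z2)).
  rewrite (dist3_sym w y') in nb.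
  lra.
Qed.

End WeakBinormal.

(** * The Frenet frame *)

Section Frenet.

Context (L : R) (c c1 c2 c3 C C1 C2 C3 : R -> R3) (tau : R -> R)
  (hL : 0 < L) (hC : is_C3 C C1 C2 C3)
  (hCc : forall x, 0 <= x <= L ->
     C x = c x /\ C1 x = c1 x /\ C2 x = c2 x /\ C3 x = c3 x)
  (hc2 : forall s, 0 <= s <= L -> c2 s <> zero)
  (harc : arc_length_param dist3 c 0 L)
  (htau : is_torsion 0 L c1 c2 tau).

Definition vderive (f : R -> R3) (x : R) (l : R3) : Prop :=
  forall j, is_derive (fun t => coord j (f t)) x (coord j l).

Lemma derive_dot (f g : R -> R3) (x : R) (f' g' : R3) :
  vderive f x f' -> vderive g x g' ->
  is_derive (fun t => dot (f t) (g t)) x (dot f' (g x) + dot (f x) g').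
Proof.
  intros hf hg.
  assert (H := fun j => Derive.is_derive_mult _ _ _ _ _ (hf j) (hg j)).
  assert (H3 := is_derive_plus _ _ _ _ _
    (is_derive_plus _ _ _ _ _ (H 0%nat) (H 1%nat)) (H 2%nat)).
  eapply is_derive_ext; [| replace (dot f' (g x) + dot (f x) g') with
    (plus (plus (coord 0 f' * coord 0 (g x) + coord 0 (f x) * coord 0 g')
                (coord 1 f' * coord 1 (g x) + coord 1 (f x) * coord 1 g'))
          (coord 2 f' * coord 2 (g x) + coord 2 (f x) * coord 2 g'));
    [apply H3 |]].
  - intros t; simpl; destruct (f t) as [[? ?] ?], (g t) as [[? ?] ?].
    unfold plus; simpl; ring.
  - destruct (f x) as [[? ?] ?], (g x) as [[? ?] ?], f' as [[? ?] ?],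
      g' as [[? ?] ?]; unfold plus; simpl; ring.
Qed.

Lemma derive_osc (x : R) : vderive (osc_normal C1 C2) x (cross (C1 x) (C3 x)).
Proof.
  assert (d1 : vderive C1 x (C2 x)) by (intros j; apply hC).
  assert (d2 : vderive C2 x (C3 x)) by (intros j; apply hC).
  assert (H : forall i k, is_derive
    (fun t => coord i (C1 t) * coord k (C2 t) - coord k (C1 t) * coord i (C2 t))
    x (coord i (C1 x) * coord k (C3 x) - coord k (C1 x) * coord i (C3 x))).
  { intros i k.
    replace (_ - _) with
      (minus (coord i (C2 x) * coord k (C2 x) + coord i (C1 x) * coord k (C3 x))
         (coord k (C2 x) * coord i (C2 x) + coord k (C1 x) * coord i (C3 x)))
      by (unfold minus, plus, opp; simpl; ring).
    apply (is_derive_minus (fun t => coord i (C1 t) * coord k (C2 t)));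
      apply Derive.is_derive_mult; auto. }
  assert (E : forall i k j,
    (forall u v, coord j (cross u v)
                 = coord i u * coord k v - coord k u * coord i v) ->
    is_derive (fun t => coord j (osc_normal C1 C2 t)) x
      (coord j (cross (C1 x) (C3 x)))).
  { intros i k j e; rewrite e; apply is_derive_ext with (2 := H i k).
    intros t; now rewrite <- e. }
  intros j; destruct j as [| [| j]];
    [apply (E 1 2)%nat | apply (E 2 0)%nat | apply (E 0 1)%nat];
    intros [[? ?] ?] [[? ?] ?]; reflexivity.
Qed.

Lemma frenet_unit (s : R) : 0 <= s <= L -> norm (C1 s) = 1.
Proof.
  intros hs; apply (arc_length_unit_speed C C1 C2 C3 hC c L); trivial.
  intros x hx; now apply hCc.
Qed.

(** The square of the speed is constant. *)
Lemma frenet_orthogonal (s : R) : 0 <= s <= L -> dot (C1 s) (C2 s) = 0.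
Proof.
  intros hs.
  assert (d1 : vderive C1 s (C2 s)) by (intros j; apply hC).
  assert (d := derive_dot C1 C1 s _ _ d1 d1).
  assert (e : dot (C2 s) (C1 s) + dot (C1 s) (C2 s) = 0).
  { apply (rel_derive_unique 0 L (fun t => dot (C1 t) (C1 t)) s); trivial.
    - now apply rel_derive_of_derive.
    - intros eps heps; exists 1; split; [lra |]; intros y hy _.
      rewrite <- !norm_sqr, !frenet_unit by trivial.
      match goal with |- Rabs ?t <= _ => replace t with 0 by ring end.
      rewrite Rabs_R0; apply Rmult_le_pos; [lra | apply Rabs_pos]. }
  assert (e' : dot (C2 s) (C1 s) = dot (C1 s) (C2 s)).
  { destruct (C1 s) as [[? ?] ?], (C2 s) as [[? ?] ?]; simpl; ring. }
  lra.
Qed.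

Lemma norm_osc (s : R) : 0 <= s <= L -> norm (osc_normal C1 C2 s) = norm (C2 s).
Proof.
  intros hs; apply norm_eq; [apply norm_ge_0 |]; rewrite norm_sqr.
  assert (u := norm_sqr (C1 s)); rewrite frenet_unit in u by trivial.
  assert (o := frenet_orthogonal s hs); unfold osc_normal.
  transitivity (dot (C1 s) (C1 s) * dot (C2 s) (C2 s)
                - dot (C1 s) (C2 s) * dot (C1 s) (C2 s)).
  - destruct (C1 s) as [[? ?] ?], (C2 s) as [[? ?] ?]; simpl; ring.
  - rewrite <- u, o; ring.
Qed.

Lemma norm_C2_pos (s : R) : 0 <= s <= L -> 0 < norm (C2 s).
Proof.
  intros hs; destruct (hCc s hs) as [_ [_ [-> _]]]; now apply norm_pos, hc2.
Qed.

Lemma osc_nonzero (s : R) : 0 <= s <= L -> osc_normal C1 C2 s <> zero.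
Proof.
  intros hs; apply norm_neq0; rewrite norm_osc by trivial.
  now apply norm_C2_pos.
Qed.

Lemma frenet_b_osc (s : R) : 0 <= s <= L ->
  frenet_b c1 c2 s = S2val (normalize (osc_normal C1 C2 s)).
Proof.
  intros hs; rewrite normalize_val, norm_osc by (trivial; now apply osc_nonzero).
  unfold frenet_b, frenet_t, frenet_n, osc_normal.
  destruct (hCc s hs) as [_ [-> [-> _]]].
  generalize (/ norm (c2 s)); intros r.
  destruct (c1 s) as [[? ?] ?], (c2 s) as [[? ?] ?].
  apply R3_ext; intros [| [| j]]; vec; ring.
Qed.

Lemma frenet_n_unit (s : R) : 0 <= s <= L -> norm (frenet_n c2 s) = 1.
Proof.
  intros hs; assert (h := norm_pos _ (hc2 s hs)); unfold frenet_n.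
  rewrite norm_scal_pos; [field; lra | left; now apply Rinv_0_lt_compat].
Qed.

Lemma rel_derive_dot (a b : R) (f : R -> R3) (s : R) (l v : R3) :
  a <= s <= b -> is_derive_in a b f s l ->
  rel_derive a b (fun x => dot (f x) v) s (dot l v).
Proof.
  intros hs h eps heps.
  assert (hv := norm_ge_0 v).
  set (e := eps / (3 * (norm v + 1))).
  assert (he : 0 < e) by (apply Rdiv_lt_0_compat; lra).
  assert (H := fun j => is_derive_in_coord a b f s l j hs h e he).
  destruct (H 0%nat) as [d0 [p0 h0]], (H 1%nat) as [d1 [p1 h1]],
    (H 2%nat) as [d2 [p2 h2]].
  exists (Rmin d0 (Rmin d1 d2)); split; [repeat apply Rmin_glb_lt; lra |].
  assert (l0 := Rmin_l d0 (Rmin d1 d2)); assert (l1 := Rmin_r d0 (Rmin d1 d2)).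
  assert (l2 := Rmin_l d1 d2); assert (l3 := Rmin_r d1 d2).
  intros y hy hys; specialize (h0 y hy ltac:(lra)).
  specialize (h1 y hy ltac:(lra)); specialize (h2 y hy ltac:(lra)).
  set (E := fun j => coord j (f y) - coord j (f s) - (y - s) * coord j l) in *.
  replace (dot (f y) v - dot (f s) v - (y - s) * dot l v) with
    (E 0%nat * coord 0 v + E 1%nat * coord 1 v + E 2%nat * coord 2 v).
  - assert (B : forall j, Rabs (E j) <= e * Rabs (y - s) ->
              Rabs (E j * coord j v) <= e * Rabs (y - s) * (norm v + 1)).
    { intros j hj; rewrite Rabs_mult; assert (q := coord_le_norm j v).
      apply Rmult_le_compat; try apply Rabs_pos; lra. }
    assert (b0 := B 0%nat h0); assert (b1 := B 1%nat h1).
    assert (b2 := B 2%nat h2).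
    replace (eps * Rabs (y - s)) with (3 * (e * Rabs (y - s) * (norm v + 1)))
      by (unfold e; field; lra).
    eapply Rle_trans; [apply Rabs_triang |].
    assert (t := Rabs_triang (E 0%nat * coord 0 v) (E 1%nat * coord 1 v)); lra.
  - unfold E; destruct (f y) as [[? ?] ?], (f s) as [[? ?] ?], l as [[? ?] ?],
      v as [[? ?] ?]; simpl; ring.
Qed.

(** The derivative of the component of the binormal along the normal at [s],
    computed in two ways. Since that component vanishes at [s], the derivative
    of the normalizing factor does not contribute. *)
Lemma abs_torsion_tau (s : R) : 0 <= s <= L ->
  abs_torsion C1 C2 C3 s = Rabs (tau s).
Proof.
  intros hs; set (v := frenet_n c2 s).
  assert (hn := norm_C2_pos s hs); assert (ho := norm_osc s hs).
  assert (d1 := rel_derive_dot 0 L _ s _ v hs (htau s hs)); fold v in d1.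
  assert (dv : vderive (fun _ => v) s (zero : R3)).
  { intros j; replace (coord j (zero : R3)) with 0
      by (destruct j as [| [| j]]; reflexivity).
    apply @is_derive_const. }
  assert (dw := derive_osc s).
  assert (dwv := derive_dot _ _ s _ _ dw dv).
  assert (dww := derive_dot _ _ s _ _ dw dw).
  assert (hpos : 0 < dot (osc_normal C1 C2 s) (osc_normal C1 C2 s)).
  { rewrite <- norm_sqr, ho; now apply Rmult_lt_0_compat. }
  assert (dn := is_derive_sqrt _ _ _ dww hpos).
  assert (hne : sqrt (dot (osc_normal C1 C2 s) (osc_normal C1 C2 s)) <> 0).
  { rewrite <- norm_R3, ho; lra. }
  assert (dq := is_derive_div _ _ _ _ _ dwv dn hne).
  set (B := fun t => dot (osc_normal C1 C2 t) v
    / sqrt (dot (osc_normal C1 C2 t) (osc_normal C1 C2 t))) in dq.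
  assert (eB : forall x, 0 <= x <= L -> dot (frenet_b c1 c2 x) v = B x).
  { intros x hx; rewrite frenet_b_osc by trivial.
    rewrite normalize_val by now apply osc_nonzero.
    unfold B; rewrite norm_R3; unfold Rdiv.
    generalize (/ sqrt (dot (osc_normal C1 C2 x) (osc_normal C1 C2 x))); intros r.
    destruct (osc_normal C1 C2 x) as [[? ?] ?], v as [[? ?] ?]; vec; ring. }
  assert (d2 := rel_derive_of_derive 0 L _ _ _ dq).
  assert (d1' : rel_derive 0 L B s (dot (scal (- tau s) v) v)).
  { intros eps heps; destruct (d1 eps heps) as [d [pd hd]].
    exists d; split; trivial; intros y hy hys.
    rewrite <- !eB by trivial; now apply hd. }
  assert (e := rel_derive_unique 0 L B s _ _ hL hs d1' d2).
  assert (hv : dot v v = 1).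
  { rewrite <- norm_sqr; unfold v; rewrite frenet_n_unit by trivial; ring. }
  assert (e1 : dot (scal (- tau s) v) v = - tau s).
  { transitivity (- tau s * dot v v); [| rewrite hv; ring].
    destruct v as [[? ?] ?]; vec; ring. }
  assert (ev : v = scal (/ norm (C2 s)) (C2 s)).
  { unfold v, frenet_n; now destruct (hCc s hs) as [_ [_ [-> _]]]. }
  assert (z0 : dot (osc_normal C1 C2 s) v = 0).
  { rewrite ev; unfold osc_normal; generalize (/ norm (C2 s)); intros q.
    destruct (C1 s) as [[? ?] ?], (C2 s) as [[? ?] ?]; vec; ring. }
  assert (z1 : dot (osc_normal C1 C2 s) (zero : R3) = 0).
  { destruct (osc_normal C1 C2 s) as [[? ?] ?]; vec; ring. }
  assert (z2 : dot (cross (C1 s) (C3 s)) v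
               = - (/ norm (C2 s) * dot (osc_normal C1 C2 s) (C3 s))).
  { rewrite ev; unfold osc_normal; generalize (/ norm (C2 s)); intros q.
    destruct (C1 s) as [[? ?] ?], (C2 s) as [[? ?] ?], (C3 s) as [[? ?] ?].
    vec; ring. }
  rewrite e1, z0, z1, z2, <- norm_R3, ho in e.
  assert (et : tau s = dot (osc_normal C1 C2 s) (C3 s)
                       / (norm (C2 s) * norm (C2 s))).
  { apply Ropp_eq_reg; rewrite e; field; lra. }
  unfold abs_torsion; rewrite frenet_unit, ho by trivial.
  rewrite et; unfold Rdiv; rewrite Rabs_mult, Rmult_1_l; f_equal.
  rewrite Rabs_pos_eq; trivial; left; apply Rinv_0_lt_compat.
  now apply Rmult_lt_0_compat.
Qed.

(** The binormal moves with speed equal to the absolute torsion. *)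
Lemma frenet_b_lipschitz (F : R -> R) :
  (forall x, 0 <= x <= L -> is_derive F x (Rabs (tau x))) ->
  forall s s', 0 <= s -> s <= s' -> s' <= L ->
    dist3 (frenet_b c1 c2 s') (frenet_b c1 c2 s) <= F s' - F s.
Proof.
  intros hF s s' hs hss hs'; unfold dist3.
  set (v := minus (frenet_b c1 c2 s') (frenet_b c1 c2 s) : R3).
  assert (hv := norm_ge_0 v).
  destruct (rel_MVT 0 L (fun x => dot (frenet_b c1 c2 x) v - norm v * F x)
    (fun x => dot (scal (- tau x) (frenet_n c2 x)) v - norm v * Rabs (tau x))
    s s') as [x [hx e]]; trivial.
  { intros x hx; apply rel_derive_minus.
    - apply rel_derive_dot; trivial; now apply htau.
    - apply rel_derive_of_derive, is_derive_scal; now apply hF. }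
  assert (h1 : dot (scal (- tau x) (frenet_n c2 x)) v <= Rabs (tau x) * norm v).
  { eapply Rle_trans; [apply dot_le_norm |].
    rewrite norm_scal_abs, Rabs_Ropp, frenet_n_unit by lra; lra. }
  assert (e2 : dot (frenet_b c1 c2 s') v - dot (frenet_b c1 c2 s) v
               = norm v * norm v).
  { rewrite norm_sqr; unfold v; destruct (frenet_b c1 c2 s') as [[? ?] ?],
      (frenet_b c1 c2 s) as [[? ?] ?]; vec; ring. }
  assert (h2 : (dot (scal (- tau x) (frenet_n c2 x)) v - norm v * Rabs (tau x))
               * (s' - s) <= 0) by nra.
  assert (h3 : norm v * norm v <= norm v * (F s' - F s)) by lra.
  destruct hv as [hv | hv].
  - now apply Rmult_le_reg_l with (norm v).
  - rewrite <- hv.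
    destruct (rel_MVT 0 L F (fun x => Rabs (tau x)) s s') as [y [hy e3]]; trivial.
    { intros y hy; apply rel_derive_of_derive; now apply hF. }
    rewrite e3; apply Rmult_le_pos; [apply Rabs_pos | lra].
Qed.

End Frenet.

Lemma abs_torsion_continuous (C C1 C2 C3 : R -> R3) (x : R) :
  is_C3 C C1 C2 C3 -> osc_normal C1 C2 x <> zero ->
  continuous (abs_torsion C1 C2 C3) x.
Proof.
  intros hC hx; assert (hn := norm_pos _ hx).
  assert (h1 : vlimF (locally x) C1 (C1 x))
    by (intros j; apply (C_continuous C C1 C2 C3 hC j x)).
  assert (h3 : vlimF (locally x) C3 (C3 x))
    by (intros j; apply (C_continuous C C1 C2 C3 hC j x)).
  assert (ho := osc_continuous C C1 C2 C3 x hC).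
  apply (limF_div (locally x)).
  - apply (limF_mult (locally x));
      [now apply limF_norm; try apply locally_filter |].
    apply (limF_comp (locally x) _ Rabs); [| apply continuous_Rabs].
    now apply limF_dot; try apply locally_filter.
  - apply (limF_mult (locally x)); apply limF_norm; trivial;
      apply locally_filter.
  - apply Rgt_not_eq; now apply Rmult_lt_0_compat.
Qed.

(** Interior points accumulate at both ends. *)
Lemma rel_continuous_agree (T : R) (f g : R -> R) : 0 < T ->
  rel_continuous 0 T f -> rel_continuous 0 T g ->
  (forall x, 0 < x < T -> f x = g x) -> forall x, 0 <= x <= T -> f x = g x.
Proof.
  intros hT hf hg e x hx; apply cond_eq; intros eps heps.
  destruct (hf x hx (eps / 2) ltac:(lra)) as [d1 [p1 h1]].
  destruct (hg x hx (eps / 2) ltac:(lra)) as [d2 [p2 h2]].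
  set (d := Rmin (Rmin d1 d2) (T / 2)).
  assert (l0 : d <= Rmin d1 d2) by apply Rmin_l.
  assert (l1 : d <= T / 2) by apply Rmin_r.
  assert (l2 := Rmin_l d1 d2); assert (l3 := Rmin_r d1 d2).
  assert (hd : 0 < d) by (repeat apply Rmin_glb_lt; lra).
  assert (hy : exists y, 0 < y < T /\ Rabs (y - x) < d).
  { destruct (Rle_lt_dec x (T / 2)).
    - exists (x + d / 2); rewrite Rabs_pos_eq by lra; lra.
    - exists (x - d / 2); rewrite Rabs_left1 by lra; lra. }
  destruct hy as [y [hy hyx]].
  specialize (h1 y ltac:(lra) ltac:(lra)); specialize (h2 y ltac:(lra) ltac:(lra)).
  rewrite e in h1 by trivial; apply Rabs_def2 in h1, h2; apply Rabs_def1; lra.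
Qed.

Lemma continuous_on_dist3 (a b : R) (f : R -> R3) :
  (forall x y, a <= x <= b -> a <= y <= b ->
     dist3 (f y) (f x) <= Rabs (y - x)) ->
  continuous_on (fun x => a <= x <= b) f.
Proof.
  intros h x hx; apply filterlim_locally; intros eps; exists eps.
  intros y hyx hy; change (Rabs (y - x) < eps) in hyx.
  assert (hc : forall j, Rabs (coord j (f y) - coord j (f x)) < eps).
  { intros j; eapply Rle_lt_trans; [| apply hyx].
    eapply Rle_trans; [| apply (h x y hx hy)].
    replace (coord j (f y) - coord j (f x)) with (coord j (minus (f y) (f x))).
    - apply coord_le_norm.
    - destruct (f y) as [[? ?] ?], (f x) as [[? ?] ?], j as [| [| j]]; vec;
        ring. }
  assert (h0 := hc 0%nat); assert (h1 := hc 1%nat); assert (h2 := hc 2%nat).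
  revert h0 h1 h2; destruct (f y) as [[? ?] ?], (f x) as [[? ?] ?].
  intros h0 h1 h2; split; [split |]; trivial.
Qed.

Theorem theorem4p3 (k : kind) (L : R) (c c1 c2 c3 : R -> R3) (tau : R -> R)
  (hL : 0 < L)
  (hC3 : class_C3 0 L c c1 c2 c3)
  (harc : arc_length_param dist3 c 0 L)
  (hc2 : forall s, 0 <= s <= L -> c2 s <> zero)
  (hclosed : k = Closed -> closes_C3 0 L c c1 c2 c3)
  (htau : is_torsion 0 L c1 c2 tau)
  (hT : TAT k c 0 L <> Finite 0) :
  exists (T : R) (t : R -> R),
    TAT k c 0 L = Finite T /\
    (forall s, 0 <= s <= L ->
       TAT (sub_kind k L s) c 0 s = Finite (t s) /\ 0 <= t s <= T) /\
    (forall bc : R -> RP2, is_weak_binormal k c 0 L T bc ->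
       exists bt : R -> S2,
         (is_lifting T bc bt /\
          forall s, 0 < s < L -> frenet_b c1 c2 s = S2val (bt (t s))) /\
         forall bt' : R -> S2,
           is_lifting T bc bt' /\
           (forall s, 0 < s < L -> frenet_b c1 c2 s = S2val (bt' (t s))) ->
           forall x, 0 <= x <= T -> bt' x = bt x) /\
    (forall s, 0 <= s <= L ->
       is_RInt (fun x => Rabs (tau x)) 0 s (t s)).
Proof.
  destruct (C3_extension L c c1 c2 c3 hL hC3)
    as [C [C1 [C2 [C3 [hC [hCc hper]]]]]].
  (* two periods contain the unrolled nodes of a closed polygonal *)
  set (M := match k with Arc => L | Closed => 2 * L end).
  assert (hM : L <= M) by (unfold M; destruct k; lra).
  assert (hCc0 : forall x, 0 <= x <= L -> C x = c x)
    by (intros; now apply hCc).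
  assert (hosc : forall x, 0 <= x <= M -> osc_normal C1 C2 x <> zero).
  { intros x hx; destruct (Rle_lt_dec x L) as [l | l].
    - apply (osc_nonzero L c c1 c2 c3 C C1 C2 C3); trivial; lra.
    - unfold M in hx; destruct k; [lra |].
      destruct (hper (hclosed eq_refl)) as [_ [s1 s2]].
      assert (h := osc_nonzero L c c1 c2 c3 C C1 C2 C3 hL hC hCc hc2 harc (x - L)
                     ltac:(lra)).
      specialize (s1 (x - L) ltac:(lra)); specialize (s2 (x - L) ltac:(lra)).
      replace (x - L + L) with x in s1, s2 by ring.
      destruct (hCc (x - L) ltac:(lra)) as [_ [e1 [e2 _]]].
      unfold osc_normal in *; now rewrite s1, s2, <- e1, <- e2. }
  set (theta := fun x => abs_torsion C1 C2 C3 (clamp 0 M x)).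
  assert (htheta : forall x, continuous theta x).
  { apply continuous_clamp; [lra |]; intros s hs eps heps.
    assert (h := abs_torsion_continuous C C1 C2 C3 s hC (hosc s hs)).
    destruct (proj1 (filterlim_locally _ _) h (mkposreal eps heps)) as [d hd].
    exists d; split; [apply cond_pos |]; intros y _ hy; exact (hd y hy). }
  assert (hat : forall x, 0 <= x <= M -> theta x = abs_torsion C1 C2 C3 x)
    by (intros; unfold theta; now rewrite clamp_id).
  set (F := fun x => RInt theta 0 x).
  assert (hF : forall x, is_derive F x (theta x))
    by (intros; now apply RInt_derive).
  assert (hF0 : F 0 = 0) by (unfold F; now rewrite RInt_point).
  assert (htt : forall x, 0 <= x <= L -> theta x = Rabs (tau x)).
  { intros x hx; rewrite hat by lra.
    now apply (abs_torsion_tau L c c1 c2 c3 C C1 C2 C3). }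
  assert (mono : forall x y, 0 <= x -> x <= y -> y <= L -> F x <= F y).
  { intros x y hx hxy hy.
    destruct (rel_MVT 0 L F theta x y) as [z [hz e]]; trivial.
    { intros; now apply rel_derive_of_derive. }
    rewrite htt in e by lra; assert (h := Rabs_pos (tau z)); nra. }
  assert (hkM : k = Closed -> M = 2 * L /\ shift_agrees L C c).
  { intros ->; split; [reflexivity | now apply hper, hclosed]. }
  assert (hTAT : TAT k c 0 L = Finite (F L)).
  { apply (TAT_eq k L c C C1 C2 C3 hL hC hCc0 harc theta F htheta hF hF0 M hosc
      hat L); trivial; [lra |].
    intros ek; split; [reflexivity | now apply hkM]. }
  assert (hFL : 0 < F L).
  { destruct (mono 0 L ltac:(lra) ltac:(lra) ltac:(lra)) as [l | e]; [lra |].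
    exfalso; apply hT; rewrite hTAT, <- e, hF0; reflexivity. }
  assert (range : forall s, 0 <= s <= L -> 0 <= F s <= F L).
  { intros s hs; split; [rewrite <- hF0 |]; apply mono; lra. }
  assert (lip : forall s s', 0 <= s <= L -> 0 <= s' <= L ->
    dist3 (frenet_b c1 c2 s') (frenet_b c1 c2 s) <= Rabs (F s' - F s)).
  { assert (h : forall s s', 0 <= s -> s <= s' -> s' <= L ->
      dist3 (frenet_b c1 c2 s') (frenet_b c1 c2 s) <= F s' - F s).
    { apply (frenet_b_lipschitz L c1 c2 tau hc2 htau).
      intros x hx; rewrite <- htt by trivial; apply hF. }
    intros s s' hs hs'; destruct (Rle_lt_dec s s').
    - rewrite Rabs_pos_eq; [apply h; lra |].
      assert (m := mono s s' ltac:(lra) ltac:(lra) ltac:(lra)); lra.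
    - rewrite Rabs_minus_sym, Rabs_pos_eq, dist3_sym; [apply h; lra |].
      assert (m := mono s' s ltac:(lra) ltac:(lra) ltac:(lra)); lra. }
  exists (F L), F; split; [trivial | split; [| split]].
  - intros s hs; split; [| now apply range].
    unfold sub_kind; destruct (Req_EM_T s L) as [-> | n]; trivial.
    destruct (Req_EM_T s 0) as [-> | n0]; [now rewrite TAT_point, hF0 |].
    apply (TAT_eq Arc L c C C1 C2 C3 hL hC hCc0 harc theta F htheta hF hF0 M hosc
      hat s); try lra; discriminate.
  - intros bc hbc.
    assert (hinv : forall x, exists s, 0 <= x <= F L -> 0 <= s <= L /\ F s = x).
    { intros x; destruct (excluded_middle_informative (0 <= x <= F L))
        as [hx | n]; [| now exists 0].
      destruct (IVT_gen F 0 L x) as [s [hs e]].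
      - intros y; apply continuity_pt_filterlim.
        apply (ex_derive_continuous (V := R_NormedModule)); now exists (theta y).
      - rewrite hF0, Rmin_left, Rmax_right; lra.
      - rewrite Rmin_left, Rmax_right in hs by lra; now exists s. }
    set (s := fun x => proj1_sig (constructive_indefinite_description _ (hinv x))).
    assert (hs : forall x, 0 <= x <= F L -> 0 <= s x <= L /\ F (s x) = x).
    { intros x; unfold s.
      now destruct (constructive_indefinite_description _ (hinv x)). }
    (* [s] is a section of [F]; its choice does not affect the binormal, which is
       constant on the fibres of [F] by [lip] *)
    set (bt := fun x => normalize (osc_normal C1 C2 (s x))).
    assert (eb : forall x, 0 <= x <= F L ->
              S2val (bt x) = frenet_b c1 c2 (s x)).
    { intros x hx; symmetry; apply (frenet_b_osc L c c1 c2 c3 C C1 C2 C3); trivial.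
      now apply hs. }
    assert (bt_lip : forall x y, 0 <= x <= F L -> 0 <= y <= F L ->
              dist3 (S2val (bt y)) (S2val (bt x)) <= Rabs (y - x)).
    { intros x y hx hy; rewrite !eb by trivial.
      destruct (hs x hx) as [h1 e1], (hs y hy) as [h2 e2].
      rewrite <- e1 at 2; rewrite <- e2 at 2; now apply lip. }
    assert (bt_frenet : forall r, 0 <= r <= L ->
              frenet_b c1 c2 r = S2val (bt (F r))).
    { intros r hr; destruct (hs (F r) (range r hr)) as [h e].
      rewrite eb by now apply range.
      apply dist3_eq0, Rle_antisym; [| apply dist3_ge0].
      eapply Rle_trans; [now apply lip |].
      rewrite e, Rminus_diag, Rabs_R0; lra. }
    assert (bt_cont : continuous_on (fun x => 0 <= x <= F L)
                        (fun x => S2val (bt x)))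
      by now apply continuous_on_dist3.
    exists bt; split; [split; [split |] |]; trivial.
    + intros x hx; destruct (hs x hx) as [h e]; rewrite <- e at 2; symmetry.
      apply (weak_binormal_value k L c C C1 C2 C3 hL hC hCc0 harc theta F htheta hF
        hF0 M hM hosc hat hkM bc); trivial; now apply range.
    + intros r hr; apply bt_frenet; lra.
    + intros bt' [[bt'_cont _] bt'_frenet] x hx.
      apply S2_eq, R3_ext; intros j; revert x hx.
      apply (rel_continuous_agree (F L)
        (fun x => coord j (S2val (bt' x))) (fun x => coord j (S2val (bt x))));
        trivial; try now apply continuous_on_coord.
      intros x hx; f_equal; destruct (hs x ltac:(lra)) as [h e].
      assert (hin : 0 < s x < L).
      { split; apply Rnot_le_lt; intros hle.
        - replace (s x) with 0 in e by lra; lra.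
        - replace (s x) with L in e by lra; lra. }
      rewrite <- e, <- bt'_frenet by trivial; apply bt_frenet; lra.
  - intros s hs; apply (is_RInt_ext theta).
    + intros x; rewrite Rmin_left, Rmax_right by lra; intros hx.
      apply htt; lra.
    + apply (RInt_correct (V := R_CompleteNormedModule)).
      apply (ex_RInt_continuous (V := R_CompleteNormedModule)).
      intros; apply htheta.
Qed.
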